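(* Assume that $\zeta_{n,1}\ge 1$ a.s. for all $n\ge 0$, that $\mathbb{E}\xi=0$, and that the family of increments $\{\xi_{i,k}\}$ is independent of the branching mechanism $\{\zeta_{n,j}\}$. Let $\mu$ be an a.s. finite non-negative integer-valued random variable that does not depend on the increments (but may depend on the branching process), i.e. the family $\{\xi_{i,k}\}$ is independent of the pair $(\mu,\{\zeta_{n,j}\})$, and assume $\mathbb{E}(\mu Z_\mu)<\infty$. Assume that $F$ is strong subexponential ($F\in\mathcal{S}^*$). Then, for any $c>0$, as $x\to\infty$, $$\mathbb{P}\left(R_{\mu}^{\widehat{c}}>x\right)\sim H_{\mu}^{\widehat{c}}(x;\widehat{\mathcal{P}})\sim\mathbb{E}\eta_\mu\cdot\overline{F}(x),$$ where $R_\mu^{\widehat c}=\max_{\pi:|\pi|\le\mu}(S(\pi)-c|\pi|)$, $H_{\mu}^{\widehat{c}}(x;\widehat{\mathcal{P}})=\sum_{n=1}^{\infty}\mathbb{E}[Z_n\mathbb{I}(\mu\ge n)]\,\overline{F}(x+cn)$ and $\eta_\mu=\sum_{n=1}^{\mu}Z_n$.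
   Context: Branching process in varying environment: $Z_0=1$, $Z_{n+1}=\sum_{j=1}^{Z_n}\zeta_{n,j}$ for $n\ge 0$, where for each $n\ge0$ the variables $\{\zeta_{n,j}\}_{j}$ are i.i.d. non-negative integer-valued with common distribution $\mathcal{P}_n$, and the sequences for different $n\ge 0$ are mutually independent; $\widehat{\mathcal{P}}=(\mathcal{P}_0,\mathcal{P}_1,\ldots)$. Its genealogical tree $\mathcal{T}$ has $Z_n$ vertices in generation $n$, numbered $1,\dots,Z_n$, vertex $j$ of generation $n$ having $\zeta_{n,j}$ children in generation $n+1$. Branching random walk: $\{\xi,\xi_{i,k}\}_{i,k\ge0}$ are i.i.d. with distribution function $F$; the edge of $\mathcal{T}$ ending at vertex $i$ of generation $k$ carries the increment $\xi_{i,k}$. For a finite path $\pi$ in $\mathcal{T}$ starting from the root, $|\pi|$ is its number of edges and $S(\pi)$ is the sum of the increments along its edges ($S(\emptyset)=0$ for the empty path). Notation: $\overline{F}(x)=1-F(x)$; $f_1\sim f_2$ means $f_1(x)=(1+o(1))f_2(x)$ as $x\to\infty$ (for positive functions, $f_1(x)/f_2(x)\to1$). A distribution $G$ on $\mathbb{R}$ is strong subexponential ($G\in\mathcal{S}^*$) if $\overline G(x)>0$ for all $x>0$, $m_{G^+}:=\int_0^\infty\overline G(y)\,dy<\infty$, and $\int_0^x\overline G(x-y)\overline G(y)\,dy\sim2m_{G^+}\overline G(x)$. *)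

(* Defs.v *)
From HB Require Import structures.
From mathcomp Require Import all_boot all_order all_algebra.
From mathcomp Require Import all_classical all_reals all_analysis.

Set Implicit Arguments.
Unset Strict Implicit.
Unset Printing Implicit Defensive.

Import Order.TTheory GRing.Theory Num.Theory.
Import numFieldNormedType.Exports.

Local Open Scope classical_set_scope.
Local Open Scope ring_scope.

Section asymptotics.
Context {R : realType}.
Implicit Types f g : R -> R.

Definition pinfty_filter_on : filter_on R :=
  FilterType (pinfty_nbhs R) _.

(* [f = g + o(g)], i.e. [f = (1 + o(1)) g]; unlike [f x / g x --> 1], this
   also makes sense when [g] vanishes. *)
Definition asymp_equiv f g : Prop :=
  (f : R -> R^o) ~_pinfty_filter_on (g : R -> R^o).

Lemma asymp_equivP f g :
  asymp_equiv f g <->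
  forall eps, 0 < eps ->
    \forall x \near +oo, `|f x - g x| <= eps * `|g x|.
Proof.
by split => [/eqaddoP h eps e0|h]; [exact: h|apply/eqaddoP => eps; exact: h].
Qed.

End asymptotics.

Section distributions.
Context {R : realType}.
Implicit Type G : probability R R.

Definition distr_fun G (x : R) : R := fine (G `]-oo, x]%classic).

Definition tail G (x : R) : R := 1 - distr_fun G x.

Definition tail_mean G : R :=
  \int[lebesgue_measure]_(y in `[0, +oo[) tail G y.

Definition strong_subexponential G : Prop :=
  [/\ forall x, 0 < x -> 0 < tail G x,
      (\int[lebesgue_measure]_(y in `[0%R, +oo[) (tail G y)%:E < +oo)%E
    & asymp_equiv
        (fun x => \int[lebesgue_measure]_(y in `[0, x])
                    (tail G (x - y) * tail G y))
        (fun x => 2 * tail_mean G * tail G x)].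

End distributions.

Section independence.
Context {d : measure_display} {T : measurableType d} {R : realType}.
Variable P : probability T R.

Definition has_law (d' : measure_display) (U : measurableType d')
    (X : {RV P >-> U}) (Q : probability U R) : Prop :=
  forall A, measurable A -> distribution P X A = Q A.

Definition sigma_family (d' : measure_display) (U : measurableType d')
    (I : Type) (X : I -> {RV P >-> U}) : set_system T :=
  <<s \bigcup_i g_sigma_algebra_preimage (X i) >>.

Definition mutually_independent (I : eqType) (G : I -> set_system T) : Prop :=
  forall (s : seq I) (E : I -> set T), uniq s ->
    (forall i, i \in s -> G i (E i)) ->
    P (\bigcap_(i in [set` s]) E i) = (\prod_(i <- s) P (E i))%E.

Definition independent (G1 G2 : set_system T) : Prop :=
  forall A B, G1 A -> G2 B -> P (A `&` B) = (P A * P B)%E.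

Definition independent_RVs (d' : measure_display) (U : measurableType d')
    (I : eqType) (X : I -> {RV P >-> U}) : Prop :=
  mutually_independent (fun i => g_sigma_algebra_preimage (X i)).

End independence.

(* A realisation of the offspring numbers is [z : nat -> nat -> nat]. All
   numberings start at 0: [z n j] is the number of children of the [j.+1]-st
   vertex of generation [n], and that generation consists of the vertices
   [j < gen_size z n]; the root is vertex 0 of generation 0. *)
Section tree.
Implicit Type z : nat -> nat -> nat.

Fixpoint gen_size z (n : nat) : nat :=
  if n is n'.+1 then (\sum_(j < gen_size z n') z n' j)%N else 1.

(* Vertices are numbered in birth order: the children of vertex [i] of
   generation [n] form a block placed after those of the vertices [k < i]. *)
Definition is_child z (n i j : nat) : bool :=
  ((\sum_(k < i) z n k)%N <= j < (\sum_(k < i.+1) z n k)%N)%N.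

(* [tree_path z n i p]: [p] lists the successive vertices, in generations
   [n.+1], [n.+2], and so on, of a path going down from vertex [i] of
   generation [n]. Hence [size p] is the number of edges. *)
Fixpoint tree_path z (n i : nat) (p : seq nat) : bool :=
  if p is j :: p' then is_child z n i j && tree_path z n.+1 j p' else true.

Definition root_path z : seq nat -> bool := tree_path z 0 0.

(* [x i k] is the increment on the edge ending at vertex [i] of
   generation [k]. *)
Definition path_sum (R : realType) (x : nat -> nat -> R) (p : seq nat) : R :=
  \sum_(k < size p) x (nth 0%N p k) k.+1.

Definition shifted_sums (R : realType) z (x : nat -> nat -> R) (c : R)
    (m : nat) : set R :=
  [set path_sum x p - c * (size p)%:R
     | p in [set p | root_path z p /\ (size p <= m)%N]].

Definition max_shifted_sum (R : realType) z (x : nat -> nat -> R) (c : R)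
    (m : nat) : R :=
  sup (shifted_sums z x c m).

Lemma finite_tree_paths z m n i :
  finite_set [set p | tree_path z n i p /\ (size p <= m)%N].
Proof.
elim: m n i => [|m IH] n i.
  apply: (sub_finite_set _ (finite_set1 [::])) => p /= [_].
  by rewrite leqn0 size_eq0 => /eqP.
pose N := (\sum_(k < i.+1) z n k)%N.
apply: (@sub_finite_set _ _ ([set [::]] `|` \bigcup_(j in `I_N)
  (cons j @` [set p | tree_path z n.+1 j p /\ (size p <= m)%N]))).
  case=> [|j p] /=; first by left.
  move=> [/andP[/andP[_ jN] pp] sp]; right; exists j => //=.
  by exists p.
rewrite finite_setU; split; first exact: finite_set1.
by apply: bigcup_finite => [|j _]; [exact: finite_II|exact: finite_image].
Qed.

(* The supremum above is a maximum. *)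
Lemma max_shifted_sumP (R : realType) z (x : nat -> nat -> R) (c : R) m :
  shifted_sums z x c m (max_shifted_sum z x c m) /\
  ubound (shifted_sums z x c m) (max_shifted_sum z x c m).
Proof.
set S := shifted_sums z x c m.
have finS : finite_set S by apply: finite_image; exact: finite_tree_paths.
have S0 : S !=set0 by exists (path_sum x [::] - c * 0%:R); exists [::].
suff [s Ss us] : exists2 s, S s & ubound S s.
  have supS : has_sup S by split => //; exists s.
  have -> : max_shifted_sum z x c m = s; last by [].
  apply/eqP; rewrite eq_le; apply/andP; split; first exact: ge_sup.
  by apply: ub_le_sup => //; case: supS.
move: S0 finS => {}[a Sa] /finite_seqP[l lE]; rewrite {}lE in Sa *.
elim: l a Sa => // b l IH a _ /=.
case: l IH => [|b' l] IH.
  by exists b; rewrite /= ?inE// => y /=; rewrite inE => /eqP ->.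
have [//|s sl us] := IH b'; first by rewrite /= inE eqxx.
exists (Num.max b s).
  by rewrite /= inE; case: (leP b s) => _; rewrite ?eqxx// sl orbT.
move=> y /=; rewrite inE => /orP[/eqP ->|yl]; first by rewrite le_max lexx.
by rewrite le_max (us y) ?orbT.
Qed.

End tree.

Section processes.
Context {d : measure_display} {T : measurableType d} {R : realType}.
Variable P : probability T R.
Variables (zeta : nat -> nat -> {RV P >-> nat}) (mu : {RV P >-> nat}).

Definition offspring (w : T) : nat -> nat -> nat := fun n j => zeta n j w.

Definition Zgen (n : nat) (w : T) : nat := gen_size (offspring w) n.

Definition eta_mu (w : T) : nat := (\sum_(1 <= n < (mu w).+1) Zgen n w)%N.

Definition Rmax (xi : nat -> nat -> {RV P >-> R}) (c : R) (w : T) : R :=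
  max_shifted_sum (offspring w) (fun i k => xi i k w) c (mu w).

(* Extended-real valued; it is finite, hence [fine] loses nothing, as soon as
   the offspring numbers are a.s. at least 1 and [mu * Zgen mu] has finite
   mean. *)
Definition Hmu (F : probability R R) (c x : R) : \bar R :=
  (\sum_(1 <= n <oo)
     'E_P[(fun w => (Zgen n w)%:R * \1_[set w' | (n <= mu w')%N] w)%R]
     * (tail F (x + c * n%:R))%:E)%E.

End processes.

(* Main.v *)
Require Import Defs.
From HB Require Import structures.
From mathcomp Require Import all_boot all_order all_algebra.
From mathcomp Require Import all_classical all_reals all_analysis.
From mathcomp Require Import measurable_realfun ring lra.

Import Order.TTheory GRing.Theory Num.Theory.
Import numFieldNormedType.Exports.

(** Write [tb] for the tail of [F]. Both asymptotic equivalences follow from dominated convergence,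
    applied after conditioning on the tree and on the horizon [mu], which are independent of the
    increments: by Tonelli's theorem the tail of [Rmax] at [x] is the average of [frozen_tree_prob x w],
    the tail of the maximum over the deterministic tree seen in [w] ([Rmax_tailE]).

    Pointwise limit. For a fixed finite tree with [N] edges the tail of the maximum is
    [(N + o(1)) * tb x]. From above, the maximum is at most the sum of the positive parts of the
    increments, and such sums have the tail of a single big jump ([positive_sum_tail]) because strong
    subexponential distributions are long-tailed ([long_tailed]) and two simultaneous large jumps are
    negligible ([self_conv_middle], [middle_jump]). From below, one edge carries a jump slightly larger
    than [x] while all the other increments stay bounded ([fixed_tree_lower]). Here [N] is the value of
    [eta_mu].

    Domination. If every vertex has a child, every root path of length at most [m] extends to one of the
    [Z_m] root paths of length [m], so the maximum is controlled by [Z_m] random walks with [m] steps of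
    drift [- c]. The essential estimate is that the maximum of the partial sums of such a walk exceeds [x]
    with probability at most [(m + 1) * C * tb x], uniformly in [m] ([frozen_walk_tail]); thus
    [C * mu * Z_mu] dominates, up to a constant.
    That estimate is a supermartingale argument. Let [h y] be the minimum of 1 and [k] times the integral
    of [tb] over [y, x + A] ([capped_tail]), where [y] is the distance to the level [x] that remains to be
    covered. Strong subexponentiality implies that, up to a factor close to one and for distances
    that are neither small nor beyond [x], the increase of [h] due to positive steps is at most
    [k * tb y] times their mean; the negative drift then wins as soon as [k] is large, and the mean of [h]
    grows by at most [k * A * tb x] per step ([capped_tail_drift]).

    The sum [Hmu] is treated in the same way: it is the mean of [Hcond], which lies between 0 and
    [eta_mu * tb x] and whose ratio to [tb x] tends to [eta_mu] by long-tailedness ([Hcond_cvg]). If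
    [eta_mu] vanishes almost surely, then so does [mu], and all the quantities compared are eventually 0. *)

Set Implicit Arguments.
Unset Strict Implicit.
Unset Printing Implicit Defensive.

Local Open Scope classical_set_scope.
Local Open Scope ring_scope.

(** * Integrals of functions with values in the unit interval *)

Lemma measurable_boolset d (T : measurableType d) (b : T -> bool) :
  measurable_fun setT b -> measurable [set x | b x].
Proof.
move=> mb; rewrite -[X in measurable X]setTI.
by have : measurable [set true] by []; move=> /(mb measurableT).
Qed.

Section unit_valued.
Context {R : realType}.
Implicit Types f g : R -> R.

(** Measurable functions with values in [0, 1]; they are integrable on bounded intervals. *)
Definition unit_valued f :=
  measurable_fun setT f /\ forall t, 0 <= f t <= 1.

(** The integral of [f] between [a] and [b], over the left-open interval; it is 0 when [b <= a]. *)
Definition itg f (a b : R) : R := \int[lebesgue_measure]_(t in `]a, b]) f t.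

Lemma unit_valuedM f g : unit_valued f -> unit_valued g ->
  unit_valued (fun t => f t * g t).
Proof.
move=> [mf f01] [mg g01]; split; first exact: measurable_funM.
move=> t; have /andP[f0 f1] := f01 t; have /andP[g0 g1] := g01 t.
by rewrite mulr_ge0//= mulr_ile1.
Qed.

Lemma unit_valued_bounded f (A : set R) : unit_valued f -> [bounded f x | x in A].
Proof.
move=> [mf f01]; exists 1; split; first exact: num_real.
move=> M M1 t _ /=; have /andP[f0 f1] := f01 t.
by rewrite ger0_norm// (le_trans f1)// ltW.
Qed.

Lemma unit_valued_integrable f (i : interval R) :
  (lebesgue_measure [set` i] < +oo)%E -> unit_valued f ->
  lebesgue_measure.-integrable [set` i] (EFin \o f).
Proof.
move=> ioo uf; apply: measurable_bounded_integrable => //.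
- by apply: measurable_funTS; case: uf.
- exact: unit_valued_bounded.
Qed.

Lemma lebesgue_itv_lty (a b : R) (x y : bool) :
  (lebesgue_measure [set` Interval (BSide x a) (BSide y b)] < +oo)%E.
Proof. by rewrite lebesgue_measure_itv/=; case: ifP => _ //; exact: ltry. Qed.

Lemma itg_integrable f a b : unit_valued f ->
  lebesgue_measure.-integrable `]a, b] (EFin \o f).
Proof. by move=> uf; apply: unit_valued_integrable => //; exact: lebesgue_itv_lty. Qed.

Lemma itgE f a b : unit_valued f ->
  (\int[lebesgue_measure]_(t in `]a, b]) (f t)%:E)%E = (itg f a b)%:E.
Proof.
move=> uf; rewrite /itg /Rintegral fineK//.
apply: integrable_fin_num => //; exact: itg_integrable.
Qed.

Lemma itg_ge0 f a b : unit_valued f -> 0 <= itg f a b.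
Proof.
by move=> [_ f01]; apply: Rintegral_ge0 => t _; case/andP: (f01 t).
Qed.

Lemma le_itg f g a b : unit_valued f -> unit_valued g ->
  (forall t, a < t <= b -> f t <= g t) -> itg f a b <= itg g a b.
Proof.
move=> uf ug fg; by apply: le_Rintegral => //; exact: itg_integrable.
Qed.

Lemma itg_ge f a b k : a <= b -> unit_valued f ->
  (forall t, a < t <= b -> k <= f t) -> k * (b - a) <= itg f a b.
Proof.
move=> ab uf kf; rewrite -lee_fin -itgE//.
have -> : (k * (b - a))%:E =
    (\int[lebesgue_measure]_(t in `]a, b]) (cst k%:E t))%E.
  rewrite integral_cst//= lebesgue_measure_itv/= lte_fin.
  case: ltgtP ab => // -> _.
  by rewrite subrr mulr0 mule0.
apply: le_integral => //.
- apply: (@measurable_bounded_integrable _ _ _ _ (cst k)) => //.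
    exact: lebesgue_itv_lty.
  exists `|k|; split; first exact: num_real.
  by move=> M kM t _ /=; exact: ltW.
- exact: itg_integrable.
- by move=> t; rewrite inE/= in_itv/= => /kf; rewrite lee_fin.
Qed.

Lemma itg_le f a b k : a <= b -> unit_valued f ->
  (forall t, a < t <= b -> f t <= k) -> itg f a b <= k * (b - a).
Proof.
move=> ab uf kf; rewrite -lee_fin -itgE//.
have -> : (k * (b - a))%:E =
    (\int[lebesgue_measure]_(t in `]a, b]) (cst k%:E t))%E.
  rewrite integral_cst//= lebesgue_measure_itv/= lte_fin.
  case: ltgtP ab => // -> _.
  by rewrite subrr mulr0 mule0.
apply: le_integral => //.
- exact: itg_integrable.
- apply: (@measurable_bounded_integrable _ _ _ _ (cst k)) => //.
    exact: lebesgue_itv_lty.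
  exists `|k|; split; first exact: num_real.
  by move=> M kM t _ /=; exact: ltW.
- by move=> t; rewrite inE/= in_itv/= => /kf; rewrite lee_fin.
Qed.

Lemma itg_split f a b c : a <= b -> b <= c -> unit_valued f ->
  itg f a c = itg f a b + itg f b c.
Proof.
move=> ab bc uf; rewrite /itg.
rewrite (@itv_bndbnd_setU _ _ _ (BRight b)) ?bnd_simp//.
rewrite Rintegral_setU//.
- rewrite -itv_bndbnd_setU ?bnd_simp//; exact: itg_integrable.
- apply/disj_setPS => t /=; rewrite !in_itv/= => -[/andP[_ tb] /andP[bt _]].
  by move: bt; rewrite ltNge tb.
Qed.

Lemma itg_empty f a b : b <= a -> itg f a b = 0.
Proof.
by move=> ba; rewrite /itg set_itv_ge ?Rintegral_set0// bnd_simp -leNgt.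
Qed.

Lemma le_itg_sub f a b a' b' : unit_valued f -> a' <= a -> b <= b' ->
  itg f a b <= itg f a' b'.
Proof.
move=> uf aa bb; have [ba|ab] := leP b a; first by rewrite itg_empty// itg_ge0.
have ab' := ltW ab.
rewrite (@itg_split f a' a)// ?(le_trans ab')// (@itg_split f a b b')//.
by rewrite addrCA lerDl addr_ge0// itg_ge0.
Qed.

End unit_valued.

(** * Tails of distributions and Tonelli's theorem *)

Section tails.
Context {R : realType} (F : probability R R).

Lemma tailE x : tail F x = fine (F `]x, +oo[%classic).
Proof.
have -> : `]x, +oo[%classic = ~` `]-oo, x]%classic :> set R by rewrite setCitvl.
rewrite probability_setC// fineB//; last exact: fin_num_measure.
Qed.

Lemma tailEfin x : (tail F x)%:E = F `]x, +oo[%classic.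
Proof. by rewrite tailE fineK// fin_num_measure. Qed.

Lemma tail_ge0 x : 0 <= tail F x.
Proof. by rewrite -lee_fin tailEfin. Qed.

Lemma tail_le1 x : tail F x <= 1.
Proof. by rewrite -lee_fin tailEfin probability_le1. Qed.

Lemma tail_nonincreasing x y : x <= y -> tail F y <= tail F x.
Proof.
move=> xy; rewrite -lee_fin !tailEfin; apply: le_measure; rewrite ?inE//.
by apply: subset_itvr; rewrite bnd_simp.
Qed.

Lemma tail_measurable : measurable_fun setT (tail F).
Proof. by apply: nonincreasing_measurable => // x y; exact: tail_nonincreasing. Qed.

Lemma unit_valued_tail (g : R -> R) : measurable_fun setT g ->
  unit_valued (fun t => tail F (g t)).
Proof.
move=> mg; split; first exact: (measurableT_comp tail_measurable).
by move=> t; rewrite tail_ge0 tail_le1.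
Qed.

Lemma measurable_lt_pair (g : R -> R) : measurable_fun setT g ->
  measurable_fun setT (fun p : R * measurableTypeR R => g p.2 < p.1).
Proof.
by move=> mg; apply: measurable_fun_ltr => //; exact: measurableT_comp mg _.
Qed.

Lemma unit_valued_lt (g h : R -> R) : measurable_fun setT g ->
  measurable_fun setT h -> unit_valued (fun t => (g t < h t)%R%:R : R).
Proof.
move=> mg mh; split; last by move=> t; case: (_ < _) => /=; rewrite ?lexx ?ler01.
have -> : (fun t => (g t < h t)%R%:R : R) = \1_[set t | g t < h t].
  by apply/funext => t; rewrite indicE; congr (_%:R); rewrite mem_setE/=.
apply: measurable_indic.
exact/measurable_boolset/measurable_fun_ltr.
Qed.

(** Tonelli's theorem for the distribution [F] and Lebesgue measure. *)
Lemma expected_itg (f g : R -> R) a b : unit_valued f -> measurable_fun setT g ->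
  (\int[F]_v (itg (fun t => f t * (g t < v)%R%:R) a b)%:E)%E =
  (itg (fun t => f t * tail F (g t)) a b)%:E.
Proof.
move=> uf mg.
have ufl v : unit_valued (fun t => f t * (g t < v)%R%:R).
  by apply: unit_valuedM => //; apply: unit_valued_lt.
have uft : unit_valued (fun t => f t * tail F (g t)).
  by apply: unit_valuedM => //; exact: unit_valued_tail.
rewrite -(itgE _ _ uft).
under eq_integral do rewrite -(itgE _ _ (ufl _)).
pose D : set R := `]a, b]%classic.
have mD : measurable D by exact: measurable_itv.
pose h (p : R * measurableTypeR R) : \bar R :=
  ((\1_D p.2 * f p.2 * (g p.2 < p.1)%R%:R)%:E)%E.
transitivity (\int[F]_v \int[lebesgue_measure]_t h (v, t))%E.
  apply: eq_integral => v _; rewrite integral_mkcond.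
  apply: eq_integral => t _; rewrite patchE /h/= indicE.
  by case: ifP => _; rewrite ?mul1r ?mul0r.
rewrite (fubini_tonelli h); last 2 first.
- apply/measurable_EFinP; apply: measurable_funM.
    apply: measurable_funM.
      by apply: (measurableT_comp (f := \1_D : measurableTypeR R -> R)) => //; exact: measurable_indic.
    by apply: (measurableT_comp (f := f : measurableTypeR R -> R)) => //; case: uf.
  have -> : (fun p : R * measurableTypeR R => (g p.2 < p.1)%R%:R : R) =
      \1_[set p : R * measurableTypeR R | g p.2 < p.1].
    by apply/funext => t; rewrite indicE; congr (_%:R); rewrite mem_setE/=.
  apply: measurable_indic.
  by apply: measurable_boolset; apply: measurable_lt_pair.
- move=> p; rewrite lee_fin mulr_ge0 ?mulr_ge0//.
  by case: uf => _ /(_ p.2) /andP[].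
rewrite [RHS]integral_mkcond; apply: eq_integral => t _.
rewrite patchE; case: ifPn => tD; last first.
  by apply: integral0_eq => v _; rewrite /h/= indicE (negbTE tD) !mul0r.
transitivity (\int[F]_v ((f t)%:E * (\1_`]g t, +oo[ v)%:E))%E.
  apply: eq_integral => v _; rewrite /h/= !indicE tD mul1r -EFinM.
  by congr (_ * _%:R)%:E; rewrite mem_setE/= in_itv/= andbT.
rewrite ge0_integralZl_EFin//; last 2 first.
- exact/measurable_EFinP/measurable_indic.
- by case: uf => _ /(_ t) /andP[].
by rewrite integral_indic// setIT EFinM tailEfin.
Qed.

End tails.

(** * Long tails and convolution squares of strong subexponential tails *)

Section layers.
Context {R : realType}.

Lemma itgZ (f : R -> R) a b k : unit_valued f ->
  itg (fun t => k * f t) a b = k * itg f a b.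
Proof. by move=> uf; rewrite /itg RintegralZl//; exact: itg_integrable. Qed.

Lemma eq_itg (f g : R -> R) a b : (forall t, f t = g t) -> itg f a b = itg g a b.
Proof. by move=> fg; congr (itg _ a b); exact/funext. Qed.

Lemma itg_itv (a b : R) (i : interval R) (p : R -> bool) :
  (forall t, (a < t <= b) && p t = (t \in i)) -> measurable_fun setT p ->
  (itg (fun t => (p t)%:R) a b)%:E = lebesgue_measure [set` i].
Proof.
move=> pi mp.
have up : unit_valued (fun t => (p t)%:R : R).
  split; last by move=> t; case: (p t); rewrite ?lexx ?ler01.
  have -> : (fun t => (p t)%:R : R) = \1_[set t | p t].
    by apply/funext => t; rewrite indicE; congr (_%:R); rewrite mem_setE/=.
  exact/measurable_indic/measurable_boolset.
rewrite -itgE//.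
transitivity (\int[lebesgue_measure]_(t in `]a, b]) (\1_[set t | p t] t)%:E)%E.
  by apply: eq_integral => t _; rewrite indicE mem_setE.
rewrite integral_indic//; last exact: measurable_boolset.
congr (lebesgue_measure _); apply/seteqP.
split=> t /=.
  by move=> [pt]; rewrite -pi in_itv/= => ->.
by rewrite -pi in_itv/= => /andP[].
Qed.

Lemma itg_layer (s B : R) :
  itg (fun t => (t < s)%R%:R) 0 B = Num.max 0 (Num.min s B).
Proof.
have mp : measurable_fun setT (fun t : R => t < s) by exact: measurable_fun_ltr.
apply: EFin_inj; have [sB|Bs] := leP s B.
  rewrite (@itg_itv _ _ `]0, s[)//.
    rewrite lebesgue_measure_itv/= lte_fin.
    by case: ltP => s0; rewrite ?sube0 ?EFinN ?oppr0 ?adde0.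
  move=> t; rewrite in_itv/=; case: (ltP 0 t) => //= t0.
  by case: (ltP t s) => ts; rewrite ?andbT ?andbF// (le_trans (ltW ts)).
rewrite (@itg_itv _ _ `]0, B])//.
  rewrite lebesgue_measure_itv/= lte_fin.
  by case: ltP => s0; rewrite ?sube0 ?EFinN ?oppr0 ?adde0.
move=> t; rewrite in_itv/=; case: (ltP 0 t) => //= t0.
by case: (leP t B) => //= tB; rewrite (le_lt_trans tB).
Qed.

Lemma itg_layer_refl (y s B : R) :
  itg (fun t => (y - t < s)%R%:R) (y - B) y = Num.max 0 (Num.min s B).
Proof.
have mp : measurable_fun setT (fun t : R => y - t < s).
  by apply: measurable_fun_ltr => //; exact: measurable_funB.
apply: EFin_inj.
rewrite (@itg_itv _ _ `](y - Num.min s B), y])//.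
  rewrite lebesgue_measure_itv/= lte_fin.
  have -> : (y - Num.min s B < y) = (0 < Num.min s B) by rewrite ltrBlDr ltrDl.
  by case: ltP => s0//; rewrite -EFinB opprB addrC subrK.
move=> t; rewrite in_itv/=.
have -> : (y - Num.min s B < t) = (y - t < s) && (y - B < t).
  by rewrite [LHS]ltrBlDr -ltrBlDl lt_min; congr andb; rewrite [RHS]ltrBlDr -ltrBlDl.
by case: (y - t < s); rewrite ?andbT ?andbF.
Qed.

End layers.

Section strong_subexp.
Context {R : realType} (F : probability R R).
Local Notation tb := (tail F).
Implicit Types x d A B b : R.

(** Both sides are the mean of the length of the part of [0, B] lying to the left of [v - c]. *)
Lemma itg_tail_layer (c B : R) :
  (itg (fun t => tb (t + c)) 0 B)%:E =
  (\int[F]_v (Num.max 0 (Num.min (v - c) B))%:E)%E.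
Proof.
have := @expected_itg R F (cst 1) (fun t => t + c) 0 B.
rewrite (eq_itg (g := fun t => tb (t + c))); last by move=> t; rewrite mul1r.
move=> <-.
- apply: eq_integral => v _; rewrite -itg_layer.
  by congr (_%:E); apply: eq_itg => t; rewrite mul1r ltrBrDr.
- by split => // t; rewrite ler01 lexx.
- exact: measurable_funD.
Qed.

Lemma itg_tail_refl (c y B : R) :
  itg (fun t => tb (y - t + c)) (y - B) y = itg (fun t => tb (t + c)) 0 B.
Proof.
apply: EFin_inj; rewrite itg_tail_layer.
have := @expected_itg R F (cst 1) (fun t => y - t + c) (y - B) y.
rewrite (eq_itg (g := fun t => tb (y - t + c))); last by move=> t; rewrite mul1r.
move=> <-.
- apply: eq_integral => v _; rewrite -(itg_layer_refl y).
  by congr (_%:E); apply: eq_itg => t; rewrite mul1r ltrBrDr.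
- by split => // t; rewrite ler01 lexx.
- by apply: measurable_funD => //; exact: measurable_funB.
Qed.

(** The part of the convolution square of the tail carried by the interval from [a] to [b]. *)
Definition self_conv (a b x : R) : R := itg (fun t => tb (x - t) * tb t) a b.

Lemma unit_valued_conv x : unit_valued (fun t => tb (x - t) * tb t).
Proof.
apply: unit_valuedM; last exact: (unit_valued_tail F).
by apply: unit_valued_tail; exact: measurable_funB.
Qed.

Lemma uv_tail : unit_valued tb. Proof. exact: (@unit_valued_tail _ F id). Qed.

(** The convolution square over [0, x] is split at [A], [B] and [x - B]; on the first two pieces and
    on the last one the tail at the larger argument is bounded below by a constant. *)
Lemma self_conv_ge (A B x : R) : 0 <= A -> A <= B -> 2 * B <= x ->
  tb x * itg tb 0 A + tb (x - A) * itg tb A B + tb x * itg tb 0 B +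
  self_conv B (x - B) x <= self_conv 0 x x.
Proof.
move=> A0 AB Bx; have uc := unit_valued_conv x; have ut := uv_tail.
rewrite /self_conv (@itg_split _ _ 0 A x)//; last by lra.
rewrite (@itg_split _ _ A B x)//; last by lra.
rewrite (@itg_split _ _ B (x - B) x)//; [|lra..].
rewrite (addrC (itg _ B (x - B))) !addrA lerD2r.
have uk (k : R) : unit_valued (fun t => tb k * tb t).
  by apply: unit_valuedM => //; split => // t; rewrite tail_ge0 tail_le1.
apply: lerD; first apply: lerD.
- rewrite -itgZ//; apply: le_itg => // t /andP[t0 tA].
  by apply: ler_wpM2r; [exact: tail_ge0|apply: tail_nonincreasing; lra].
- rewrite -itgZ//; apply: le_itg => // t /andP[t0 tA].
  by apply: ler_wpM2r; [exact: tail_ge0|apply: tail_nonincreasing; lra].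
- have e0 : itg (fun t => tb (x - t)) (x - B) x = itg tb 0 B.
    have := itg_tail_refl 0 x B.
    rewrite (eq_itg (g := fun t => tb (x - t))); last by move=> t; rewrite addr0.
    by move=> ->; apply: eq_itg => t; rewrite addr0.
  rewrite -e0 -itgZ; last by apply: unit_valued_tail; exact: measurable_funB.
  apply: le_itg => //.
    apply: unit_valuedM; first by split => // t; rewrite tail_ge0 tail_le1.
    by apply: unit_valued_tail; exact: measurable_funB.
  move=> t /andP[tB tx]; rewrite mulrC; apply: ler_wpM2l; first exact: tail_ge0.
  exact: tail_nonincreasing.
Qed.

Lemma self_conv_ge0 a b x : 0 <= self_conv a b x.
Proof. exact/itg_ge0/unit_valued_conv. Qed.

Hypothesis Fsse : strong_subexponential F.

Lemma tail_gt0 x : 0 < tb x.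
Proof.
case: Fsse => tb0 _ _; have [x0|x0] := ltP 0 x; first exact: tb0.
by apply: (lt_le_trans (tb0 1 ltr01)); apply: tail_nonincreasing; lra.
Qed.

Lemma tail_mean_fin : (tail_mean F)%:E =
  (\int[lebesgue_measure]_(y in `[0%R, +oo[) (tail F y)%:E)%E.
Proof.
case: Fsse => _ moo _; rewrite /tail_mean /Rintegral fineK//.
rewrite ge0_fin_numE//; apply: integral_ge0 => t _.
by rewrite lee_fin tail_ge0.
Qed.

Lemma itg_tail_cc n : (itg tb 0 n)%:E =
  (\int[lebesgue_measure]_(y in `[0%R, n]) (tail F y)%:E)%E.
Proof.
rewrite /itg Rintegral_itv_obnd_cbnd; last exact/itg_integrable/uv_tail.
rewrite /Rintegral fineK//; apply: integrable_fin_num => //.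
exact: unit_valued_integrable (lebesgue_itv_lty _ _ _ _) uv_tail.
Qed.

Lemma itg_tail_near_mean d : 0 < d ->
  exists2 B : R, 0 <= B & forall b, B <= b -> tail_mean F - d <= itg tb 0 b.
Proof.
move=> d0.
have := @ge0_cvgn_integral R lebesgue_measure tb (tail_ge0 F) (tail_measurable F).
rewrite -tail_mean_fin => /fine_cvgP[_ /cvgrPdist_le /(_ _ d0)[n _ nP]].
exists n%:R => // b nb.
have /= := nP n (leqnn n); rewrite -itg_tail_cc/= ler_norml => /andP[_ h].
have : itg tb 0 n%:R <= itg tb 0 b by apply: le_itg_sub => //; exact: uv_tail.
lra.
Qed.

Lemma self_conv_le d : 0 < d ->
  \forall x \near +oo, self_conv 0 x x <= (2 * tail_mean F + d) * tb x.
Proof.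
move=> d0; case: Fsse => _ _ /asymp_equivP h.
have m0 : 0 <= tail_mean F by apply: Rintegral_ge0 => t _; exact: tail_ge0.
have e0 : 0 < d / (2 * tail_mean F + 1) by rewrite divr_gt0// ltr_wpDl// mulr_ge0.
apply: filterS (h _ e0) => x; rewrite -Rintegral_itv_obnd_cbnd; last first.
  exact/itg_integrable/unit_valued_conv.
rewrite -/(itg _ 0 x) -/(self_conv 0 x x) => hx.
have := le_trans (ler_norm _) hx.
rewrite lerBlDl => /le_trans; apply.
rewrite ger0_norm; last by rewrite !mulr_ge0// tail_ge0.
rewrite [leRHS]mulrDl lerD2l mulrA; apply: ler_wpM2r; first exact: tail_ge0.
rewrite mulrAC ler_pdivrMr; last by rewrite ltr_wpDl// mulr_ge0.
by rewrite ler_wpM2l ?(ltW d0)//; lra.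
Qed.

(** Strong subexponential distributions are long-tailed: in [self_conv_ge], the difference between
    [tb (x - A)] and [tb x] is weighted by an integral bounded below by [J], whereas the excess of
    the convolution square over its asymptotic value is arbitrarily small. *)
Lemma long_tailed A d : 0 <= A -> 0 < d ->
  \forall x \near +oo, tb (x - A) <= (1 + d) * tb x.
Proof.
move=> A0 d0; set J := itg tb A (A + 1).
have J0 : 0 < J.
  apply: (lt_le_trans (tail_gt0 (A + 1))).
  have -> : tb (A + 1) = tb (A + 1) * (A + 1 - A) by rewrite addrAC subrr add0r mulr1.
  apply: itg_ge uv_tail _; first by lra.
  by move=> t /andP[_ tA]; exact: tail_nonincreasing.
have e0 : 0 < d * J / 3 by rewrite divr_gt0// mulr_gt0.
have [B0 B00 B0P] := itg_tail_near_mean e0.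
pose B := Num.max B0 (A + 1).
have B0B : B0 <= B by rewrite le_max lexx.
have AB : A + 1 <= B by rewrite le_max lexx orbT.
near=> x.
have cx : self_conv 0 x x <= (2 * tail_mean F + d * J / 3) * tb x.
  by near: x; exact: self_conv_le.
have Bx : 2 * B <= x by near: x; apply: nbhs_pinfty_ge; exact: num_real.
have A1B : A <= B by lra.
have := self_conv_ge A0 A1B Bx.
have := itg_split A0 A1B uv_tail.
have := self_conv_ge0 B (x - B) x.
have := B0P _ B0B.
have JAB : J <= itg tb A B by apply: le_itg_sub => //; exact: uv_tail.
set I0A := itg tb 0 A; set I0B := itg tb 0 B; set IAB := itg tb A B in JAB *.
move=> hm c0 Is hc.
have tx := tail_gt0 x; have txA : tb x <= tb (x - A) by apply: tail_nonincreasing; lra.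
set m := tail_mean F in cx hm; set t := tb x in cx hc tx txA *.
set u := tb (x - A) in hc txA *.
have h1 : (u - t) * IAB <= t * (2 * m + d * J / 3 - 2 * I0B).
  rewrite -subr_ge0; rewrite Is in hc *; nra.
have h2 : t * (2 * m + d * J / 3 - 2 * I0B) <= t * (d * J).
  by rewrite ler_pM2l//; lra.
have h3 : (u - t) * J <= (u - t) * IAB by rewrite ler_wpM2l// subr_ge0.
have : (u - t) * J <= (d * t) * J by rewrite (le_trans h3)// (le_trans h1)// (le_trans h2)// mulrCA mulrA.
by rewrite ler_pM2r// mulrDl mul1r lerBlDl.
Unshelve. all: by end_near. Qed.

(** In the convolution square of the tail, the arguments that are both large contribute little. *)
Lemma self_conv_middle d : 0 < d -> exists2 B0 : R, 0 <= B0 &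
  forall B, B0 <= B -> \forall x \near +oo, self_conv B (x - B) x <= d * tb x.
Proof.
move=> d0; have e0 : 0 < d / 3 by rewrite divr_gt0.
have [B0 B00 B0P] := itg_tail_near_mean e0.
exists B0 => // B B0B; near=> x.
have cx : self_conv 0 x x <= (2 * tail_mean F + d / 3) * tb x.
  by near: x; exact: self_conv_le.
have Bx : 2 * B <= x by near: x; apply: nbhs_pinfty_ge; exact: num_real.
have B1 : 0 <= B by lra.
have := self_conv_ge (lexx 0) B1 Bx; rewrite itg_empty// mulr0 add0r subr0.
have := B0P _ B0B; have tx := tail_gt0 x.
set I0B := itg tb 0 B; set m := tail_mean F in cx *; set t := tb x in cx tx *.
move=> hm hc; nra.
Unshelve. all: by end_near. Qed.

(** Long-tailedness for large arguments, and positivity of the tail for the others. *)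
Lemma tail_shift_ratio : exists2 C : R, 0 < C & forall u : R, 0 <= u -> tb u <= C * tb (u + 1).
Proof.
have [M [_ MP]] := long_tailed ler01 ltr01.
pose N := Num.max M 0 + 1.
have MN : M < N by rewrite ltr_pwDr// le_max lexx.
have N0 : 0 <= N by rewrite addr_ge0// le_max lexx orbT.
have tN := tail_gt0 (N + 1).
have i0 : 0 < (tb (N + 1))^-1 by rewrite invr_gt0.
exists (2 + (tb (N + 1))^-1); first by lra.
move=> u u0; have tu := tail_gt0 (u + 1); rewrite mulrDl.
have [uN|Nu] := leP u N; last first.
  have := MP (u + 1); rewrite addrK => h.
  have : tb u <= (1 + 1) * tb (u + 1) by apply: h; lra.
  move=> /le_trans; apply; rewrite lerDl mulr_ge0//; exact: ltW.
rewrite (le_trans (tail_le1 F u))//.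
rewrite -[leLHS]add0r lerD// ?mulr_ge0 ?(ltW tu)//.
by rewrite ler_pdivlMl// mulr1; apply: tail_nonincreasing; lra.
Qed.

End strong_subexp.

(** * A test function with nonpositive drift *)

Lemma integral_cst_prob d (T : measurableType d) (R : realType)
  (P : probability T R) (k : R) : (\int[P]_v k%:E = k%:E)%E.
Proof. by rewrite -[RHS]mule1 -(probability_setT P) -integral_cst. Qed.

Section drift.
Context {R : realType} (F : probability R R).
Local Notation tb := (tail F).
Implicit Types x d A B b c : R.

Hypothesis Fint : F.-integrable setT (EFin \o (@id R)).
Hypothesis Fmean : (\int[F]_v v%:E = 0)%E.

(** Truncating the negative part of the steps far enough away keeps their mean
    negative. *)
Lemma truncated_mean c : 0 < c -> exists A p q : R, [/\ 0 <= A, 0 <= p & 0 <= q] /\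
  [/\ (\int[F]_v (Num.max 0 (v - c))%:E = p%:E)%E,
  (\int[F]_v (Num.min (Num.max 0 (c - v)) A)%:E = q%:E)%E & p - q <= - (c / 2)].
Proof.
move=> c0.
have mB : measurable_fun setT (fun v : R => v - c) by exact: measurable_funB.
have mC : measurable_fun setT (fun v : R => c - v) by exact: measurable_funB.
have Fc : F.-integrable setT (fun v => (v - c)%:E).
  have -> : (fun v => (v - c)%:E) = ((EFin \o id) \- cst c%:E)%E.
    by apply/funext => v; rewrite /= EFinB.
  apply: integrableB => //; exact: finite_measure_integrable_cst.
have Ec : (\int[F]_v (v - c)%:E = - c%:E)%E.
  under eq_integral do rewrite EFinB.
  rewrite integralB//; last exact: finite_measure_integrable_cst.
  by rewrite Fmean integral_cst_prob sub0e.
have Fp : F.-integrable setT (fun v => (Num.max 0 (v - c))%:E).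
  apply: le_integrable Fc => //.
    by apply/measurable_EFinP; apply: measurable_maxr.
  by move=> v _ /=; rewrite lee_fin; case: (leP 0 (v - c)) => // _; rewrite normr0.
have Fn : F.-integrable setT (fun v => (Num.max 0 (c - v))%:E).
  apply: le_integrable Fc => //.
    by apply/measurable_EFinP; apply: measurable_maxr.
  move=> v _ /=; rewrite lee_fin distrC.
  by case: (leP 0 (c - v)) => // _; rewrite normr0.
pose fA (n : nat) (v : R) : \bar R := (Num.min (Num.max 0 (c - v)) n%:R)%:E.
have mfA n : measurable_fun setT (fA n).
  by apply/measurable_EFinP; apply: measurable_minr => //; apply: measurable_maxr.
have fA0 n v : (0 <= fA n v)%E.
  by rewrite lee_fin le_min le_max lexx ler0n.
have [_ _ cvA] : [/\ F.-integrable setT (fun v => (Num.max 0 (c - v))%:E),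
    (\int[F]_v `|fA n v - (Num.max 0 (c - v))%:E| @[n --> \oo] --> 0)%E &
    (\int[F]_v fA n v @[n --> \oo] --> \int[F]_v (Num.max 0 (c - v))%:E)%E].
  apply: (dominated_convergence measurableT) => //.
  - by apply/measurable_EFinP; apply: measurable_maxr.
  - apply: aeW => v _; apply: cvg_near_cst.
    by apply: filterS (nbhs_infty_ger (Num.max 0 (c - v))) => n h; rewrite /fA min_l.
  - exact: Fn.
  - apply: aeW => v n _; rewrite gee0_abs//.
    by rewrite /fA lee_fin ge_min lexx.
set f := fun v => (Num.max 0 (c - v))%:E in Fn cvA.
set p := fine (\int[F]_v (Num.max 0 (v - c))%:E)%E.
set r := fine (\int[F]_v (Num.max 0 (c - v))%:E)%E.
have pE : (\int[F]_v (Num.max 0 (v - c))%:E = p%:E)%E.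
  by rewrite /p fineK//; apply: integrable_fin_num.
have rE : (\int[F]_v (Num.max 0 (c - v))%:E = r%:E)%E.
  by rewrite /r fineK//; apply: integrable_fin_num.
have p0 : 0 <= p.
  by apply: fine_ge0; apply: integral_ge0 => v _; rewrite lee_fin le_max lexx.
have prc : p - r = - c.
  apply: EFin_inj; rewrite EFinB -pE -rE -integralB// EFinN -Ec.
  apply: eq_integral => v _; rewrite -EFinB; congr (_%:E).
  by case: (leP 0 (v - c)); case: (leP 0 (c - v)); lra.
move: cvA; rewrite rE => /fine_cvgP[[N _ NP]] /cvgrPdist_le.
have c2 : 0 < c / 2 by rewrite divr_gt0.
move=> /(_ _ c2)[M _ MP].
pose n := maxn N M.
have fin : (\int[F]_v fA n v)%E \is a fin_num by apply: NP; rewrite /= leq_maxl.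
have close : `|r - fine (\int[F]_v fA n v)%E| <= c / 2.
  by apply: MP; rewrite /= leq_maxr.
exists n%:R, p, (fine (\int[F]_v fA n v)%E); split; split => //.
- by apply: fine_ge0; apply: integral_ge0 => v _; exact: fA0.
- by rewrite fineK.
- by move: close; rewrite ler_norml => /andP[_]; lra.
Qed.

Hypothesis Fsse : strong_subexponential F.

(** The left-hand side is the mean, over a step [v - c], of the integral of the tail from [y - (v - c)],
    or from [B] if that is larger, up to [y]. It is at most [tb y] times the mean [p] of the
    positive part of the step, up to an error of relative size [d]. *)
Lemma jump_bound p d c : 0 <= c -> 0 < d -> 0 <= p ->
  (\int[F]_v (Num.max 0 (v - c))%:E = p%:E)%E ->
  exists2 B : R, 0 <= B & \forall y \near +oo,
    itg (fun z => tb z * tb (y - z + c)) B y <= (d + (1 + d) * p) * tb y.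
Proof.
move=> c0 d0 p0 pE; have [B B0 BP] := self_conv_middle Fsse d0.
exists B => //; near=> y.
have By : 2 * B <= y by near: y; apply: nbhs_pinfty_ge; exact: num_real.
have hc : self_conv F B (y - B) y <= d * tb y by near: y; exact: BP.
have hB : tb (y - B) <= (1 + d) * tb y by near: y; exact: long_tailed.
have uf : unit_valued (fun z => tb (y - z + c)).
  by apply: unit_valued_tail; apply: measurable_funD => //; exact: measurable_funB.
have ug : unit_valued (fun z => tb z * tb (y - z + c)).
  by apply: unit_valuedM => //; exact: uv_tail.
rewrite (@itg_split _ _ B (y - B))//; [|lra..].
rewrite mulrDl; apply: lerD.
  apply: le_trans hc; apply: le_itg => //; first exact: unit_valued_conv.
  move=> t _; rewrite mulrC; apply: ler_wpM2r; first exact: tail_ge0.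
  by apply: tail_nonincreasing; lra.
apply: (@le_trans _ _ (tb (y - B) * itg (fun z => tb (y - z + c)) (y - B) y)).
  rewrite -itgZ//; apply: le_itg => //.
    apply: unit_valuedM => //; split => // t.
    by rewrite tail_ge0 tail_le1.
  move=> t /andP[t0 _]; apply: ler_wpM2r; first exact: tail_ge0.
  by apply: tail_nonincreasing; lra.
rewrite itg_tail_refl [leRHS]mulrAC.
apply: ler_pM => //; [exact: tail_ge0|by apply/itg_ge0/unit_valued_tail; exact: measurable_funD|].
rewrite -lee_fin itg_tail_layer -pE; apply: ge0_le_integral => //.
- by move=> v _; rewrite lee_fin le_max lexx.
- apply/measurable_EFinP; apply: measurable_maxr => //; apply: measurable_minr => //.
  exact: measurable_funB.
- by apply/measurable_EFinP; apply: measurable_maxr => //; exact: measurable_funB.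
- move=> v _; rewrite lee_fin ge_max le_max lexx/= le_max.
  by apply/orP; right; rewrite ge_min lexx.
Unshelve. all: by end_near. Qed.

(** The integrated tail from [y] to [x + A], capped at 1. Here [y] is the distance from the current
    position of the walk to the level [x]; a negative [y] means that the level is exceeded. Stopping
    the integral at [x + A], rather than at infinity, makes the value at the start [y = x]
    comparable with [tb x]. *)
Definition capped_tail (k A x y : R) : R := Num.min 1 (k * itg tb y (x + A)).

Lemma capped_tail_nonincreasing k A x y z : 0 <= k -> y <= z ->
  capped_tail k A x z <= capped_tail k A x y.
Proof.
move=> k0 yz; rewrite /capped_tail le_min ge_min lexx/= ge_min; apply/orP; right.
by apply: ler_wpM2l => //; apply: le_itg_sub => //; exact: uv_tail.
Qed.

Lemma capped_tail_ge0 k A x y : 0 <= k -> 0 <= capped_tail k A x y.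
Proof. by move=> k0; rewrite le_min ler01 mulr_ge0//; exact/itg_ge0/uv_tail. Qed.

Lemma capped_tail_le1 k A x y : capped_tail k A x y <= 1.
Proof. by rewrite ge_min lexx. Qed.

Lemma capped_tail_measurable k A x : 0 <= k -> measurable_fun setT (capped_tail k A x).
Proof.
by move=> k0; apply: nonincreasing_measurable => // y z; exact: capped_tail_nonincreasing.
Qed.

(** The effect of one step [s]. A step [s <= 0] gains at least the second term on the left-hand side,
    a positive step of length at most [y - B] costs at most the last term, and a longer one costs at
    most 1. *)
Lemma capped_tail_step k A x y s B v c : 0 <= k -> 0 <= A -> 0 <= B -> B <= y -> y <= x ->
  s = v - c ->
  capped_tail k A x (y - s) + k * (Num.min (Num.max 0 (- s)) A * tb (y + A)) <=
  k * itg tb y (x + A) + ((y - B < s)%R%:R +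
    k * itg (fun z => tb z * (y - z + c < v)%R%:R) B y).
Proof.
move=> k0 A0 B0 By yx sE; have ut := uv_tail F.
have uz : unit_valued (fun z => tb z * (y - z + c < v)%R%:R).
  apply: unit_valuedM => //; apply: unit_valued_lt => //.
  by apply: measurable_funD => //; exact: measurable_funB.
have i0 := itg_ge0 B y uz.
have b0 : 0 <= (y - B < s)%R%:R :> R by case: (_ < _); rewrite ?ler01.
have hle z : capped_tail k A x z <= k * itg tb z (x + A) by rewrite ge_min lexx orbT.
have [s0|s0] := leP s 0.
  set e := Num.min _ A; have e0 : 0 <= e by rewrite le_min A0 le_max lexx.
  have eA : e <= A by rewrite ge_min lexx orbT.
  have es : e <= - s by rewrite /e ge_min max_r ?oppr_ge0// lexx.
  rewrite (@itg_split _ tb y (y + e))//; [|lra..].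
  have h1 : capped_tail k A x (y - s) <= k * itg tb (y + e) (x + A).
    apply: le_trans (hle _) _; apply: ler_wpM2l => //.
    by apply: le_itg_sub => //; lra.
  have h2 : e * tb (y + A) <= itg tb y (y + e).
    have -> : e * tb (y + A) = tb (y + A) * (y + e - y) by ring.
    apply: itg_ge => //; first by lra.
    by move=> t /andP[_ te]; apply: tail_nonincreasing; lra.
  apply: (le_trans (lerD h1 (ler_wpM2l k0 h2))).
  rewrite mulrDr [X in _ <= X + _]addrC lerDl.
  by apply: addr_ge0 => //; exact: mulr_ge0.
have -> : Num.min (Num.max 0 (- s)) A = 0.
  by rewrite max_l ?oppr_le0 1?ltW// min_l.
rewrite mul0r mulr0 addr0.
have [sy|ys] := leP s (y - B); last first.
  apply: le_trans (capped_tail_le1 _ _ _ _) _.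
  by rewrite -[leLHS]add0r lerD ?mulr_ge0 ?itg_ge0//= lerDl mulr_ge0.
apply: le_trans (hle _) _; rewrite add0r -mulrDr; apply: ler_wpM2l => //.
rewrite (@itg_split _ tb (y - s) y)//; [|lra..].
rewrite addrC lerD2l.
apply: (@le_trans _ _ (itg (fun z => tb z * (y - z + c < v)%R%:R) (y - s) y)); last first.
  by apply: le_itg_sub => //; lra.
apply: le_itg => // t /andP[ts _].
have -> : (y - t + c < v) by lra.
by rewrite mulr1.
Qed.

(** The mean of [capped_tail_step] over the step [v - c]. *)
Lemma capped_tail_integral k A B c q x y : 0 <= k -> 0 <= A -> 0 <= B ->
  B <= y -> y <= x ->
  (\int[F]_v (Num.min (Num.max 0 (c - v)) A)%:E = q%:E)%E ->
  (\int[F]_v (capped_tail k A x (y - (v - c)))%:E <=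
   (k * itg tb y (x + A) + (tb (y - B + c) +
     k * itg (fun z => tb z * tb (y - z + c)) B y) - k * tb (y + A) * q)%:E)%E.
Proof.
move=> k0 A0 B0 By yx qE.
pose g (v z : R) := tb z * (y - z + c < v)%R%:R.
have mg : measurable_fun setT (fun z : R => y - z + c).
  by apply: measurable_funD => //; exact: measurable_funB.
have ug v : unit_valued (g v).
  by apply: unit_valuedM; [exact: uv_tail|exact: unit_valued_lt].
have mstep : measurable_fun setT (fun v : R => (capped_tail k A x (y - (v - c)))%:E).
  apply/measurable_EFinP; apply: (measurableT_comp (capped_tail_measurable A x k0)) => //.
  by apply: measurable_funB => //; exact: measurable_funB.
pose I : R -> R := \1_`]y - B + c, +oo[.
have mI : measurable_fun setT (fun v : R => (I v)%:E).
  by apply/measurable_EFinP; exact: measurable_indic.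
have mJ : measurable_fun setT (fun v : R => (itg (g v) B y)%:E).
  apply/measurable_EFinP; apply: nondecreasing_measurable => // v w vw.
  apply: le_itg => // t _; rewrite /g; apply: ler_wpM2l; first exact: tail_ge0.
  by rewrite ler_nat; case: (ltP _ v) => // /lt_le_trans ->.
have m0v v : 0 <= k * tb (y + A) * Num.min (Num.max 0 (c - v)) A.
  by rewrite !mulr_ge0 ?tail_ge0// le_min A0 le_max lexx.
have mm : measurable_fun setT (fun v : R => (Num.min (Num.max 0 (c - v)) A)%:E).
  apply/measurable_EFinP; apply: measurable_minr => //; apply: measurable_maxr => //.
  exact: measurable_funB.
have h0 v : (0 <= (capped_tail k A x (y - (v - c)))%:E)%E.
  by rewrite lee_fin capped_tail_ge0.
have kI0 : (0 <= (k * itg tb y (x + A))%:E)%E.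
  by rewrite lee_fin mulr_ge0// itg_ge0//; exact: uv_tail.
have J0 v : (0 <= k%:E * (itg (g v) B y)%:E)%E by rewrite -EFinM lee_fin mulr_ge0// itg_ge0.
have I0 v : (0 <= (I v)%:E)%E by rewrite lee_fin.
have mkJ : measurable_fun setT (fun v : R => k%:E * (itg (g v) B y)%:E)%E.
  exact: emeasurable_funM.
have mkm : measurable_fun setT (fun v : R => (k * tb (y + A))%:E *
    (Num.min (Num.max 0 (c - v)) A)%:E)%E by exact: emeasurable_funM.
have mIJ : measurable_fun setT (fun v : R => (I v)%:E +
    k%:E * (itg (g v) B y)%:E)%E by exact: emeasurable_funD.
have : (\int[F]_v ((capped_tail k A x (y - (v - c)))%:E +
      (k * tb (y + A))%:E * (Num.min (Num.max 0 (c - v)) A)%:E) <=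
      \int[F]_v ((k * itg tb y (x + A))%:E + ((I v)%:E +
       k%:E * (itg (g v) B y)%:E)))%E.
  apply: ge0_le_integral => //.
  - by move=> v _; rewrite -EFinM adde_ge0// lee_fin.
  - exact: emeasurable_funD.
  - exact: emeasurable_funD.
  - move=> v _; rewrite -!EFinM -!EFinD lee_fin.
    have -> : k * tb (y + A) * Num.min (Num.max 0 (c - v)) A =
        k * (Num.min (Num.max 0 (- (v - c))) A * tb (y + A)).
      by rewrite opprB [in RHS]mulrC; ring.
    have -> : I v = (y - B < v - c)%R%:R :> R.
      by rewrite /I indicE mem_setE in_itv/= andbT ltrBrDr.
    exact: capped_tail_step.
rewrite ge0_integralD//; last by move=> v _; rewrite -EFinM lee_fin.
rewrite ge0_integralD//; last by move=> v _; rewrite adde_ge0.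
have IE : (\int[F]_v (I v)%:E = (tb (y - B + c))%:E)%E.
  by rewrite integral_indic// setIT tailEfin.
rewrite ge0_integralD// integral_cst_prob IE.
rewrite ge0_integralZl_EFin//; last 2 first.
- by move=> v _; rewrite lee_fin le_min A0 le_max lexx.
- by rewrite mulr_ge0// tail_ge0.
rewrite qE ge0_integralZl_EFin//; last by move=> v _; rewrite lee_fin itg_ge0.
rewrite expected_itg//; last exact: uv_tail.
by rewrite -!EFinM -!EFinD -leeBrDr// -EFinB.
Qed.

(** For large [x], one step of the walk increases the mean of [capped_tail] by at most
    [k * A * tb x]. *)
Lemma capped_tail_drift c : 0 < c -> exists k A x0 : R, [/\ 0 <= k, 0 <= A & forall x, x0 <= x ->
  [/\ forall y, y < 0 -> capped_tail k A x y = 1,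
     capped_tail k A x x <= k * A * tb x &
     forall y, (\int[F]_v (capped_tail k A x (y - (v - c)))%:E <=
        (capped_tail k A x y + k * A * tb x)%:E)%E]].
Proof.
move=> c0; have [A [p [q [[A0 p0 q0] [pE qE pq]]]]] := truncated_mean c0.
(* With this choice, an error of relative size [d] in each mean consumes only half of the drift
   [c / 2] of the truncated steps. *)
pose d := c / (4 * (1 + p + q)).
have d0 : 0 < d by rewrite divr_gt0// mulr_gt0// -addrA ltr_wpDr ?addr_ge0.
have dE : d * (1 + p + q) = c / 4.
  by rewrite /d; field; apply/eqP; lra.
have [B B0 [M1 [_ BP]]] := jump_bound (ltW c0) d0 p0 pE.
have [M2 [_ lA]] := long_tailed Fsse A0 d0.
have [M3 [_ lB]] := long_tailed Fsse B0 d0.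
(* Beyond [x1] all the asymptotic estimates are valid. *)
pose x1 := Num.max (Num.max (M1 + 1) M2) (Num.max (M3 + 1) B).
have [x1M1 x1M2 x1M3 x1B] : [/\ M1 + 1 <= x1, M2 <= x1, M3 + 1 <= x1 & B <= x1].
  by rewrite /x1; split; rewrite !le_max lexx ?orbT.
pose J := itg tb x1 (x1 + 1).
have J0 : 0 < J.
  apply: (lt_le_trans (tail_gt0 Fsse (x1 + 1))).
  have -> : tb (x1 + 1) = tb (x1 + 1) * (x1 + 1 - x1) by rewrite addrAC subrr add0r mulr1.
  apply: itg_ge (uv_tail F) _; first by lra.
  by move=> t /andP[_ tA]; exact: tail_nonincreasing.
(* The first bound on [k] makes [capped_tail] equal to 1 up to [x1]; the second one lets the negative
   drift compensate the steps longer than [y - B]. *)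
pose k := Num.max (J^-1) (4 * (1 + d) / c).
have k0 : 0 <= k by rewrite le_max invr_ge0 ltW.
have kJ : 1 <= k * J by rewrite -ler_pdivrMr// mul1r le_max lexx.
have kc : 4 * (1 + d) <= k * c by rewrite -ler_pdivrMr// le_max lexx orbT.
have ut := uv_tail F.
exists k, A, (x1 + 1); split => // x x1x.
have hx1 y : y <= x1 -> 1 <= k * itg tb y (x + A).
  move=> yx1; apply: le_trans kJ _; apply: ler_wpM2l => //.
  by apply: le_itg_sub => //; lra.
have hx : capped_tail k A x x <= k * A * tb x.
  rewrite /capped_tail ge_min; apply/orP; right; rewrite -mulrA; apply: ler_wpM2l => //.
  have -> : A * tb x = tb x * (x + A - x) by rewrite addrAC subrr add0r mulrC.
  apply: itg_le => //; first by lra.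
  by move=> t /andP[xt _]; apply: tail_nonincreasing; exact: ltW.
have mstep y : measurable_fun setT (fun v : R => (capped_tail k A x (y - (v - c)))%:E).
  apply/measurable_EFinP; apply: (measurableT_comp (capped_tail_measurable A x k0)) => //.
  by apply: measurable_funB => //; exact: measurable_funB.
(* There is no increase at all before the level [x] is exceeded. *)
have drift y : y <= x ->
    (\int[F]_v (capped_tail k A x (y - (v - c)))%:E <= (capped_tail k A x y)%:E)%E.
  move=> yx; rewrite {2}/capped_tail; case: (leP 1 (k * itg tb y (x + A))) => [h1|h1].
    rewrite -(integral_cst_prob F 1); apply: ge0_le_integral => //.
      by move=> v _; rewrite lee_fin capped_tail_ge0.
    by move=> v _; rewrite lee_fin capped_tail_le1.
  have x1y : x1 < y by rewrite ltNge; apply/negP => /hx1; rewrite leNgt h1.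
  have hA : tb y <= (1 + d) * tb (y + A).
    by have := lA (y + A); rewrite addrK; apply; lra.
  have hB : tb (y - B) <= (1 + d) * tb y by apply: lB; lra.
  have hJ := BP y _; have {}hJ := hJ ltac:(lra).
  rewrite (le_trans (capped_tail_integral k0 A0 B0 _ yx qE))//; first by lra.
  rewrite lee_fin; move: hJ; set j := itg _ B y => hJ.
  have hBc : tb (y - B + c) <= (1 + d) * tb y.
    by apply: le_trans hB; apply: tail_nonincreasing; lra.
  have hta : tb (y + A) <= tb y by apply: tail_nonincreasing; lra.
  have ty := tail_gt0 Fsse y; set ta := tb (y + A) in hA hta *; set t := tb y in hA hta hBc hJ ty *.
  set tc := tb (y - B + c) in hBc *.
  have h2 : (1 - d) * t <= ta.
    by have : d * ta <= d * t; [rewrite ler_wpM2l// ltW|lra].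
  have h3 : k * j <= k * ((d + (1 + d) * p) * t) by rewrite ler_wpM2l.
  have h4 : k * ((1 - d) * t * q) <= k * (ta * q) by rewrite ler_wpM2l// ler_wpM2r.
  have h5 : (d + (1 + d) * p) - (1 - d) * q <= - (c / 4) by nra.
  have h6 : k * t * ((d + (1 + d) * p) - (1 - d) * q) <= k * t * (- (c / 4)).
    by rewrite ler_wpM2l// mulr_ge0// ltW.
  have h7 : 4 * (1 + d) * t <= k * c * t by rewrite ler_wpM2r// ltW.
  have -> : k * ta * q = k * (ta * q) by rewrite mulrA.
  by lra.
split => //.
- by move=> y y0; rewrite /capped_tail min_l//; apply: hx1; lra.
(* For [y > x], monotonicity reduces the claim to [y = x]. *)
- move=> y; have [yx|xy] := leP y x.
    apply: le_trans (drift _ yx) _; rewrite lee_fin lerDl.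
    by rewrite mulr_ge0 ?mulr_ge0 ?tail_ge0.
  apply: (@le_trans _ _ (\int[F]_v (capped_tail k A x (x - (v - c)))%:E)%E).
    apply: ge0_le_integral => //.
      by move=> v _; rewrite lee_fin capped_tail_ge0.
    move=> v _; rewrite lee_fin; apply: capped_tail_nonincreasing => //.
    by rewrite lerB// ltW.
  apply: le_trans (drift _ (lexx x)) _; rewrite lee_fin (le_trans hx)// lerDr.
  exact: capped_tail_ge0.
Qed.
End drift.

(** * Independent pairs and independence of the past *)

Section independent_pair.
Context d d1 d2 (T : measurableType d) (T1 : measurableType d1)
  (T2 : measurableType d2) (R : realType) (P : probability T R).
Variables (U : T -> T1) (V : T -> T2).
Hypotheses (mU : measurable_fun setT U) (mV : measurable_fun setT V).
Hypothesis UV : forall A B, measurable A -> measurable B ->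
  P (U @^-1` A `&` V @^-1` B) = (P (U @^-1` A) * P (V @^-1` B))%E.
Variable phi : T1 * T2 -> \bar R.
Hypotheses (mphi : measurable_fun setT phi) (phi0 : forall p, (0 <= phi p)%E).

Lemma measurable_section_integral :
  measurable_fun setT (fun w => \int[P]_w' phi (U w, V w'))%E.
Proof.
pose V' : {mfun T >-> T2} := HB.pack V (isMeasurableFun.Build _ _ _ _ V mV).
have -> : (fun w => \int[P]_w' phi (U w, V w'))%E =
    fubini_F (distribution P V') phi \o U.
  apply/funext => w /=; rewrite /fubini_F ge0_integral_distribution//.
  exact: measurableT_comp mphi (pair1_measurable _).
apply: measurableT_comp mU.
exact: measurable_fun_fubini_tonelli_F.
Qed.

(** Tonelli's theorem for two independent random elements defined on the same space: the mean of
    [phi (U, V)] is computed with independent copies of the sample point. *)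
Lemma independent_pair_integral :
  (\int[P]_w phi (U w, V w) = \int[P]_w \int[P]_w' phi (U w, V w'))%E.
Proof.
pose U' : {mfun T >-> T1} := HB.pack U (isMeasurableFun.Build _ _ _ _ U mU).
pose V' : {mfun T >-> T2} := HB.pack V (isMeasurableFun.Build _ _ _ _ V mV).
have mUV : measurable_fun setT (fun w => (U w, V w)) by exact: measurable_fun_pair.
pose UV' : {mfun T >-> (T1 * T2)%type} :=
  HB.pack (fun w => (U w, V w)) (isMeasurableFun.Build _ _ _ _ (fun w => (U w, V w)) mUV).
transitivity (\int[distribution P UV']_z phi z)%E.
  by rewrite ge0_integral_distribution.
transitivity (\int[distribution P U' \x distribution P V']_z phi z)%E.
  apply: eq_measure_integral => A mA _.
  symmetry; apply: product_measure_unique => //.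
rewrite fubini_tonelli1//.
rewrite (@ge0_integral_distribution _ _ _ _ _ _ U')//; last 2 first.
- exact: measurable_fun_fubini_tonelli_F.
- by move=> y; apply: integral_ge0.
apply: eq_integral => w _ /=; rewrite /fubini_F ge0_integral_distribution//.
exact: measurableT_comp mphi (pair1_measurable _).
Qed.

End independent_pair.

Lemma bigcap_cons (I : eqType) (T : Type) (E : I -> set T) (i : I) (s : seq I) :
  \bigcap_(j in [set` i :: s]) E j = E i `&` \bigcap_(j in [set` s]) E j.
Proof.
apply/seteqP; split=> [x h|x [xi h] j /=].
  by split=> [|j js]; apply: h; rewrite /= inE ?eqxx// js orbT.
by rewrite inE => /orP[/eqP ->//|]; exact: h.
Qed.

Section independent_past.
Context d (T : measurableType d) (R : realType) (P : probability T R).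
Context (I : eqType) (X : I -> {RV P >-> R}).

(** The sigma-algebra generated by the variables indexed by [s]. *)
Definition gens (s : seq I) : set_system T :=
  \bigcup_(j in [set` s]) g_sigma_algebra_preimage (X j).

Lemma gens_measurable s : gens s `<=` measurable.
Proof. by move=> A [j _ [B mB <-]]; rewrite setTI; exact: measurable_funPTI. Qed.

Lemma measurable_gens s j : j \in s ->
  measurable_fun setT (X j : g_sigma_algebraType (gens s) -> R).
Proof.
move=> js _ B mB; apply: sub_sigma_algebra; exists j => //.
by exists B.
Qed.

Lemma sigma_gens_measurable s A : <<s gens s >> A -> measurable A.
Proof.
by apply: smallest_sub; [exact: sigma_algebra_measurable|exact: gens_measurable].
Qed.

Lemma measurable_fun_gens d' (T' : measurableType d') s (U : T -> T') :
  measurable_fun setT (U : g_sigma_algebraType (gens s) -> T') ->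
  measurable_fun setT U.
Proof.
by move=> mU _ B mB; apply: (@sigma_gens_measurable s); exact: mU.
Qed.

Hypothesis Xindep : independent_RVs X.

(** A variable is independent of the sigma-algebra generated by finitely many others: the finite
    intersections of events of the generating variables form a pi-system on which two finite
    measures agree. *)
Lemma independent_past (s : seq I) i A B : uniq s -> i \notin s ->
  <<s gens s >> A -> measurable B ->
  P (A `&` X i @^-1` B) = (P A * P (X i @^-1` B))%E.
Proof.
move=> us ins sA mB.
pose D := X i @^-1` B; have mD : measurable D by exact: measurable_funPTI.
(* The pi-system of the finite intersections. *)
pose pi : set_system T := [set C | exists E : I -> set T,
  (forall j, g_sigma_algebra_preimage (X j) (E j)) /\ C = \bigcap_(j in [set` s]) E j].
have gX j E : g_sigma_algebra_preimage (X j) E -> measurable E.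
  by move=> [B' mB' <-]; rewrite setTI; exact: measurable_funPTI.
have gI j E F : g_sigma_algebra_preimage (X j) E -> g_sigma_algebra_preimage (X j) F ->
    g_sigma_algebra_preimage (X j) (E `&` F).
  move=> [E' mE' <-] [F' mF' <-]; exists (E' `&` F'); first exact: measurableI.
  by rewrite !setTI preimage_setI.
have pimeas : [set Y | pi Y /\ Y `<=` setT] `<=` measurable.
  move=> Y [[E [hE ->]] _]; elim: s {us ins sA pi} => [|j s IH].
    by rewrite set_nil bigcap_set0.
  by rewrite bigcap_cons; apply: measurableI => //; exact: gX (hE j).
have piI : setI_closed [set Y | pi Y /\ Y `<=` setT].
  move=> Y Z [[E [hE ->]] _] [[F [hF ->]] _]; split => //.
  exists (fun j => E j `&` F j); split; first by move=> j; exact: gI.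
  by rewrite bigcapI.
have PD0 : 0 <= fine (P D) by rewrite fine_ge0.
have PDE : P D = (fine (P D))%:E by rewrite fineK// fin_num_measure.
pose m2 := mscale (NngNum PD0) P.
have key Y : pi Y -> mrestr P mD Y = m2 Y.
  move=> [E [hE ->]]; rewrite /mrestr /m2 /mscale/= -PDE.
  pose E' j := if j == i then D else E j.
  have E'P j : g_sigma_algebra_preimage (X j) (E' j).
    rewrite /E'; case: eqP => [->|_]; last exact: hE.
    by exists B => //; rewrite setTI.
  have E's j : j \in s -> E' j = E j.
    by move=> js; rewrite /E'; case: eqP => // ji; move: ins; rewrite -ji js.
  have h1 : P (\bigcap_(j in [set` s]) E j) = (\prod_(j <- s) P (E j))%E.
    exact: Xindep.
  have h2 := Xindep (s := i :: s) (E := E').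
  have -> : \bigcap_(j in [set` s]) E j `&` D = \bigcap_(j in [set` i :: s]) E' j.
    rewrite bigcap_cons {1}/E' eqxx setIC; congr (_ `&` _).
    by apply: eq_bigcapr => j /E's.
  rewrite h2/= ?ins//.
  rewrite big_cons {1}/E' eqxx h1; congr (_ * _)%E.
  by apply: eq_big_seq => j /E's ->.
have : mrestr P mD A = m2 A.
  apply: (g_sigma_algebra_measure_unique_trace pi setT) => //.
  - apply: key; exists (fun=> setT); split; last by rewrite bigcapT.
    by move=> j; exists setT => //; rewrite preimage_setT setTI.
  - by move=> Y [+ _]; exact: key.
  - rewrite [ltLHS](_ : _ = P D); first by rewrite PDE ltry.
    by rewrite -[in RHS](setTI D).
  - move: A sA; apply: smallest_sub; first exact: smallest_sigma_algebra.
    move=> Y [j js jY]; apply: sub_sigma_algebra; split => //.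
    exists (fun k => if k == j then Y else setT); split.
      move=> k; case: eqP => [->//|_]; exists setT => //.
      by rewrite preimage_setT setTI.
    apply/seteqP; split => x.
      by move=> Yx k /= _; case: eqP.
    by move=> /(_ j js); rewrite eqxx.
by rewrite /mrestr /m2 /mscale/= -PDE muleC.
Qed.

End independent_past.

(** * Maxima of partial sums and sums of positive parts *)

Section walk.
Context d (T : measurableType d) (R : realType) (P : probability T R).
Context (I : eqType) (X : I -> {RV P >-> R}) (F : probability R R).
Hypothesis Xindep : independent_RVs X.
Hypothesis Xlaw : forall i, has_law (X i) F.
Local Notation tb := (tail F).

Lemma law_integral i (phi : R -> \bar R) :
  measurable_fun setT phi -> (forall v, 0 <= phi v)%E ->
  (\int[P]_w phi (X i w) = \int[F]_v phi v)%E.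
Proof.
move=> mphi phi0; rewrite -(ge0_integral_distribution (X i) mphi phi0).
by apply: eq_measure_integral => A mA _; exact: Xlaw.
Qed.

Lemma law_tail i x : P [set w | x < X i w] = (tb x)%:E.
Proof.
rewrite tailEfin -(Xlaw i)//; congr (P _).
by apply/seteqP; split => w /=; rewrite in_itv/= andbT.
Qed.

(** The final position of the walk with steps [X i - c], for [i] along [s], stopped the first time that
    it exceeds the level [x]. *)
Definition frozen_walk c x s (w : T) : R :=
  foldl (fun u i => if x < u then u else u + (X i w - c)) 0 s.

Lemma frozen_walk_measurable c x s t : {subset s <= t} ->
  measurable_fun setT (frozen_walk c x s : g_sigma_algebraType (gens X t) -> R).
Proof.
elim/last_ind: s => [|s i IH] st; first exact: measurable_cst.
have mX : measurable_fun setT (X i : g_sigma_algebraType (gens X t) -> R).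
  by apply: measurable_gens; apply: st; rewrite mem_rcons inE eqxx.
have {}IH : measurable_fun setT (frozen_walk c x s : g_sigma_algebraType (gens X t) -> R).
  by apply: IH => j js; apply: st; rewrite mem_rcons inE js orbT.
have -> : frozen_walk c x (rcons s i) = fun w =>
    if x < frozen_walk c x s w then frozen_walk c x s w
    else frozen_walk c x s w + (X i w - c).
  by apply/funext => w; rewrite /frozen_walk foldl_rcons.
apply: measurable_fun_ifT => //; first exact: measurable_fun_ltr.
by apply: measurable_funD => //; exact: measurable_funB.
Qed.

(** A frozen walk ends above the level [x] as soon as some partial sum does. *)
Lemma frozen_walk_gt c x s k w : 
  x < \sum_(i <- take k s) (X i w - c) -> 0 <= x -> x < frozen_walk c x s w.
Proof.
move=> + x0; suff H u : x < u + \sum_(i <- take k s) (X i w - c) ->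
    x < foldl (fun u i => if x < u then u else u + (X i w - c)) u s.
  by rewrite -[ltRHS]add0r => /H.
have stay v t : x < v ->
    x < foldl (fun u i => if x < u then u else u + (X i w - c)) v t.
  by elim: t => //= j t IH xv; rewrite xv IH.
elim: s k u => [|i s IH] [|k] u /=; rewrite ?big_nil ?addr0//.
- by move=> xu; rewrite xu stay.
- rewrite big_cons addrA; case: ifPn => [xu _|_]; first exact: stay.
  exact: IH.
Qed.

Hypothesis Fint : F.-integrable setT (EFin \o (@id R)).
Hypothesis Fmean : (\int[F]_v v%:E = 0)%E.
Hypothesis Fsse : strong_subexponential F.

(** The probability that one of the first [n] partial sums of the walk exceeds [x] is at most
    [(n + 1) * C * tb x], with the same [C] for all [n] and all large [x]. *)
Lemma frozen_walk_tail c : 0 < c -> exists C x0 : R, [/\ 0 <= C, 0 <= x0 &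
  forall x s, x0 <= x -> uniq s ->
   (P [set w | x < frozen_walk c x s w]%R <= ((size s).+1%:R * C * tb x)%:E)%E].
Proof.
move=> c0; have [k [A [x0 [k0 A0 hx]]]] := capped_tail_drift Fint Fmean Fsse c0.
exists (k * A), (Num.max 0 x0); split; [exact: mulr_ge0|by rewrite le_max lexx|].
move=> x s; rewrite ge_max => /andP[x_ge0 x0x] us.
have [h1 hxx hdrift] := hx _ x0x.
pose h := capped_tail F k A x.
have h0 y : 0 <= h y by exact: capped_tail_ge0.
have mh : measurable_fun setT h by exact: capped_tail_measurable.
have mW t : measurable_fun setT (frozen_walk c x t).
  by apply: (@measurable_fun_gens _ _ _ _ _ X _ _ t); exact: frozen_walk_measurable.
have mhW t : measurable_fun setT (fun w => (h (x - frozen_walk c x t w))%:E).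
  apply/measurable_EFinP; apply: (measurableT_comp mh).
  exact: measurable_funB.
(* The mean of the test function along the frozen walk grows by at most [k * A * tb x] per step. *)
have bound t : uniq t -> (\int[P]_w (h (x - frozen_walk c x t w))%:E <=
    ((size t).+1%:R * (k * A) * tb x)%:E)%E.
  elim/last_ind: t => [_|t i IH].
    rewrite /frozen_walk/= subr0 integral_cst_prob lee_fin mul1r.
    by rewrite (le_trans hxx).
  rewrite rcons_uniq => /andP[it ut].
  pose phi (p : R * R) : \bar R :=
    (h (x - (if x < p.1 then p.1 else p.1 + (p.2 - c))))%:E.
  have mphi : measurable_fun setT phi.
    apply/measurable_EFinP; apply: (measurableT_comp mh).
    apply: measurable_funB => //; apply: measurable_fun_ifT => //.
      exact: measurable_fun_ltr.
    by apply: measurable_funD => //; exact: measurable_funB.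
  have phi0 p : (0 <= phi p)%E by rewrite lee_fin.
  have -> : (\int[P]_w (h (x - frozen_walk c x (rcons t i) w))%:E =
      \int[P]_w phi (frozen_walk c x t w, X i w))%E.
    by apply: eq_integral => w _; rewrite /phi/= /frozen_walk foldl_rcons.
  rewrite (independent_pair_integral (mW t) _ _ mphi)//; last first.
    move=> B D mB mD; apply: (independent_past Xindep ut it) => //.
    have := @frozen_walk_measurable c x t t (fun j js => js).
    by move=> /(_ measurableT _ mB); rewrite setTI.
  apply: (@le_trans _ _ (\int[P]_w ((h (x - frozen_walk c x t w))%:E + (k * A * tb x)%:E))%E).
    apply: ge0_le_integral => //.
    - by move=> w _; exact: integral_ge0.
    - exact: (measurable_section_integral P (mW t) _ mphi).
    - exact: emeasurable_funD.
    move=> w _; rewrite (law_integral i (phi := fun v => phi (frozen_walk c x t w, v)))//; last first.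
      exact: measurableT_comp mphi (pair1_measurable _).
    have [xu|ux] := ltP x (frozen_walk c x t w).
      rewrite (_ : (fun v => phi _) = cst (h (x - frozen_walk c x t w))%:E); last first.
        by apply/funext => v; rewrite /phi/= xu.
      by rewrite integral_cst_prob -EFinD lee_fin lerDl mulr_ge0 ?tail_ge0// mulr_ge0.
    rewrite (_ : (fun v => phi _) =
        fun v => (h (x - frozen_walk c x t w - (v - c)))%:E); last first.
      by apply/funext => v; rewrite /phi/= ltNge ux/= opprD addrA.
    by rewrite -EFinD; exact: hdrift.
  have K0 : 0 <= k * A * tb x by rewrite mulr_ge0 ?tail_ge0// mulr_ge0.
  rewrite ge0_integralD//; last by move=> w _; rewrite lee_fin.
  rewrite integral_cst_prob.
  rewrite (le_trans (leeD (IH ut) (lexx _)))// -EFinD lee_fin size_rcons.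
  by rewrite -[in leRHS]natr1 [leRHS]mulrAC mulrDl mul1r mulrAC -mulrAC mulrDl; lra.
apply: le_trans (bound s us).
rewrite -[X in P X]setIT -integral_indic//; last first.
  by apply: measurable_boolset; exact: measurable_fun_ltr.
apply: ge0_le_integral => //.
- exact/measurable_EFinP/measurable_indic/measurable_boolset/measurable_fun_ltr.
- move=> w _; rewrite lee_fin indicE; have [xw|wx] := ltP x (frozen_walk c x s w).
    by rewrite mem_set// /h h1// subr_lt0.
  by rewrite memNset//=; apply/negP; rewrite -leNgt.
Qed.

End walk.

Section middle_jump.
Context (R : realType) (F : probability R R).
Local Notation tb := (tail F).
Hypothesis Fsse : strong_subexponential F.

(** A jump between [B] and [x - B] hardly contributes to the event that it exceeds [x] when added to
    an independent variable with tail [tb]. *)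
Lemma middle_jump e : 0 < e -> exists2 B0 : R, 0 <= B0 & forall B, B0 <= B ->
  \forall x \near +oo,
    (\int[F]_v ((B < v <= x - B)%R%:R * tb (x - v))%:E <= (e * tb x)%:E)%E.
Proof.
move=> e0; have [C C0 CP] := tail_shift_ratio Fsse.
have e1 : 0 < e / (C * C) by rewrite divr_gt0// mulr_gt0.
have [B0 B00 B0P] := self_conv_middle Fsse e1.
exists (B0 + 2); first by rewrite addr_ge0.
move=> B BB; have B1 : B0 <= B - 1 by lra.
near=> x.
have hc : self_conv F (B - 1) (x - (B - 1)) x <= e / (C * C) * tb x.
  by near: x; exact: B0P.
have xB : 2 * B <= x by near: x; apply: nbhs_pinfty_ge; exact: num_real.
(* [tb (x - v)] is compared with the integral of [tb (x - t)] for [t] from [v - 1] to [v]. The shift by 1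
   costs a factor [C]; replacing [tb (t - 1)] by [tb t] costs another one. *)
pose f (v t : R) := tb (x - t) * (t - 1 < v)%R%:R.
have ux : unit_valued (fun t => tb (x - t)).
  by apply: unit_valued_tail; exact: measurable_funB.
have mg : measurable_fun setT (fun t : R => t - 1) by exact: measurable_funB.
have uf v : unit_valued (f v).
  by apply: unit_valuedM => //; exact: unit_valued_lt.
have mJ : measurable_fun setT (fun v : R => (itg (f v) (B - 1) (x - B))%:E).
  apply/measurable_EFinP; apply: nondecreasing_measurable => // v w vw.
  apply: le_itg => // t _; rewrite /f; apply: ler_wpM2l; first exact: tail_ge0.
  by rewrite ler_nat; case: (ltP _ v) => // /lt_le_trans ->.
have C0' := ltW C0.
apply: (@le_trans _ _ (\int[F]_v (C%:E * (itg (f v) (B - 1) (x - B))%:E))%E).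
  apply: ge0_le_integral => //.
  - by move=> v _; rewrite lee_fin mulr_ge0// tail_ge0.
  - apply/measurable_EFinP; apply: measurable_funM; last by case: ux.
    have -> : (fun v => (B < v <= x - B)%R%:R : R) = \1_`]B, x - B].
      by apply/funext => v; rewrite indicE mem_setE in_itv.
    exact: measurable_indic.
  - exact: emeasurable_funM.
  move=> v _; rewrite -EFinM lee_fin; have j0 := itg_ge0 (B - 1) (x - B) (uf v).
  case: (boolP (B < v <= x - B)) => [/andP[Bv vx]|_]; last by rewrite mul0r mulr_ge0.
  rewrite mul1r (le_trans (CP (x - v) _))//; first by lra.
  apply: ler_wpM2l => //.
  apply: (@le_trans _ _ (itg (f v) (v - 1) v)); last by apply: le_itg_sub => //; lra.
  have -> : tb (x - v + 1) = tb (x - v + 1) * (v - (v - 1)) by ring.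
  apply: itg_ge => //; first by lra.
  move=> t /andP[vt tv]; rewrite /f; have -> : t - 1 < v by lra.
  by rewrite mulr1; apply: tail_nonincreasing; lra.
rewrite ge0_integralZl_EFin//; last by move=> v _; rewrite lee_fin itg_ge0.
rewrite expected_itg// -EFinM lee_fin.
have -> : e * tb x = C * (C * (e / (C * C) * tb x)) by field; rewrite gt_eqF.
apply: ler_wpM2l => //; apply: (le_trans _ (ler_wpM2l C0' hc)).
have uc := unit_valued_conv F x.
have u1 : unit_valued (fun t => tb (x - t) * tb (t - 1)).
  by apply: unit_valuedM => //; exact: unit_valued_tail.
rewrite /self_conv -itgZ//.
apply: (@le_trans _ _ (itg (fun t => C * (tb (x - t) * tb t)) (B - 1) (x - B))); last first.
  rewrite !itgZ//; apply: ler_wpM2l => //; apply: le_itg_sub => //; lra.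
rewrite itgZ// -lee_fin EFinM -!itgE//.
rewrite -ge0_integralZl_EFin//; last 2 first.
- by move=> t _; rewrite lee_fin mulr_ge0// tail_ge0.
- by apply/measurable_EFinP; apply: measurable_funTS; case: uc.
apply: ge0_le_integral => //.
- by move=> t _; rewrite lee_fin mulr_ge0// tail_ge0.
- by apply/measurable_EFinP; apply: measurable_funTS; case: u1.
- apply: emeasurable_funM => //.
  by apply/measurable_EFinP; apply: measurable_funTS; case: uc.
move=> t /=; rewrite in_itv/= => /andP[Bt _].
rewrite -EFinM lee_fin mulrCA; apply: ler_wpM2l; first exact: tail_ge0.
rewrite (le_trans (CP _ _)) ?subrK//; lra.
Unshelve. all: by end_near. Qed.

End middle_jump.

Section positive_sum.
Context d (T : measurableType d) (R : realType) (P : probability T R).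
Context (I : eqType) (X : I -> {RV P >-> R}) (F : probability R R).
Hypothesis Xindep : independent_RVs X.
Hypothesis Xlaw : forall i, has_law (X i) F.
Hypothesis Fsse : strong_subexponential F.
Local Notation tb := (tail F).

(** The sum of the positive parts of the variables indexed by [s]. *)
Definition positive_sum s (w : T) : R := \sum_(i <- s) Num.max 0 (X i w).

Lemma positive_sum_measurable s t : {subset s <= t} ->
  measurable_fun setT (positive_sum s : g_sigma_algebraType (gens X t) -> R).
Proof.
elim: s => [|i s IH] st.
  rewrite (_ : positive_sum [::] = cst 0)//.
  by apply/funext => w; rewrite /positive_sum big_nil.
rewrite (_ : positive_sum (i :: s) = fun w => Num.max 0 (X i w) + positive_sum s w); last first.
  by apply/funext => w; rewrite /positive_sum big_cons.
apply: measurable_funD; last by apply: IH => j js; apply: st; rewrite inE js orbT.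
apply: measurable_maxr => //; apply: measurable_gens; apply: st.
by rewrite inE eqxx.
Qed.

(** Finite sums of positive parts have at most the tail of a single big jump. *)
Lemma positive_sum_tail s e : uniq s -> 0 < e ->
  \forall x \near +oo, (P [set w | x < positive_sum s w]%R <= (((size s)%:R + e) * tb x)%:E)%E.
Proof.
elim: s e => [|i s IH] e /=.
  move=> _ e0; near=> x.
  have x0 : 0 <= x by near: x; apply: nbhs_pinfty_ge; exact: num_real.
  rewrite (_ : mkset _ = set0) ?measure0 ?lee_fin ?mulr_ge0 ?tail_ge0 ?add0r ?ltW//.
  by rewrite -subset0 => w /=; rewrite /positive_sum big_nil ltNge x0.
move=> /andP[ins us] e0; set N : R := (size s)%:R; have N0 : 0 <= N by rewrite ler0n.
have e4 : 0 < e / 4 by rewrite divr_gt0.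
pose dl := e / (4 * (N + 1 + e)).
have dl0 : 0 < dl by rewrite divr_gt0// mulr_gt0// -addrA ltr_wpDl// addr_gt0.
have eN : 0 < e / (4 * (N + 1)) by rewrite divr_gt0// mulr_gt0// ltr_wpDl.
have [M [_ MP]] := IH _ us ltr01.
have [B0 B00 B0P] := middle_jump Fsse eN.
pose B := Num.max B0 (M + 1).
have B0B : B0 <= B by rewrite le_max lexx.
have MB : M + 1 <= B by rewrite le_max lexx orbT.
have B_ge0 : 0 <= B := le_trans B00 B0B.
have [M' [_ M'P]] := IH _ us e4.
have mY : measurable_fun setT (positive_sum s).
  by apply: (@measurable_fun_gens _ _ _ _ _ X _ _ s); exact: positive_sum_measurable.
have mYs (x : R) : measurable [set w | x < positive_sum s w].
  by apply: measurable_boolset; exact: measurable_fun_ltr.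
have mX (x : R) : measurable [set w | x < X i w].
  by apply: measurable_boolset; exact: measurable_fun_ltr.
near=> x.
have hlt : tb (x - B) <= (1 + dl) * tb x by near: x; exact: long_tailed.
have hmid : (\int[F]_v ((B < v <= x - B)%R%:R * tb (x - v))%:E <=
    (e / (4 * (N + 1)) * tb x)%:E)%E by near: x; exact: B0P.
have xM' : M' + B < x by near: x; apply: nbhs_pinfty_gt; exact: num_real.
(* If the new variable adds to the sum [Y] of the others to exceed [x], then either [Y > x - B], or the
   new variable is larger than [x - B], or it lies between [B] and [x - B]: this last event is [A3]. *)
pose A3 := X i @^-1` `]B, x - B] `&` [set w | x < positive_sum s w + X i w].
have mA3 : measurable A3.
  apply: measurableI; first exact: measurable_funPTI.
  by apply: measurable_boolset; apply: measurable_fun_ltr => //; exact: measurable_funD.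
have sub : [set w | x < positive_sum (i :: s) w] `<=`
    [set w | x - B < positive_sum s w] `|` [set w | x - B < X i w] `|` A3.
  move=> w /=; rewrite {1}/positive_sum big_cons -/(positive_sum s w) => xw.
  have [h1|h1] := ltP (x - B) (positive_sum s w); first by left; left.
  have [h2|h2] := ltP (x - B) (X i w); first by left; right.
  right; split; rewrite /= ?in_itv/= ?h2 ?andbT; move: xw; case: (leP 0 (X i w)) => h3.
  - by rewrite addrC; lra.
  - by lra.
  - by rewrite addrC.
  - by lra.
have hY : (P [set w | (x - B < positive_sum s w)%R] <= ((N + e / 4) * tb (x - B))%:E)%E.
  by apply: M'P; lra.
have hA3 : (P A3 <= ((N + 1) * (e / (4 * (N + 1)) * tb x))%:E)%E.
  pose phi (p : R * R) : \bar R := ((B < p.1 <= x - B) && (x < p.2 + p.1))%R%:R%:E.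
  have mphi : measurable_fun setT phi.
    apply/measurable_EFinP.
    have -> : (fun p => ((B < p.1 <= x - B) && (x < p.2 + p.1))%:R : R) =
        \1_[set p : R * R | (B < p.1 <= x - B) && (x < p.2 + p.1)].
      by apply/funext => p; rewrite indicE mem_setE.
    apply/measurable_indic/measurable_boolset; apply: measurable_and.
      by apply: measurable_and; [exact: measurable_fun_ltr|exact: measurable_fun_ler].
    by apply: measurable_fun_ltr => //; exact: measurable_funD.
  have phi0 p : (0 <= phi p)%E by rewrite lee_fin ler0n.
  have indYX A D : measurable A -> measurable D ->
      P (X i @^-1` A `&` positive_sum s @^-1` D) =
      (P (X i @^-1` A) * P (positive_sum s @^-1` D))%E.
    move=> mA mD; rewrite setIC muleC; apply: (independent_past Xindep us ins) => //.
    have := @positive_sum_measurable s s (fun j js => js).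
    by move=> /(_ measurableT _ mD); rewrite setTI.
  have -> : P A3 = (\int[P]_w phi (X i w, positive_sum s w))%E.
    rewrite -[A3]setIT -integral_indic//; apply: eq_integral => w _.
    rewrite indicE /phi/=; congr (_%:R%:E).
    congr (nat_of_bool _); apply/idP/idP => [/set_mem[/=]|/andP[h1 h2]].
      by rewrite in_itv/= => ->.
    by apply/mem_set; split => //=; rewrite in_itv.
  rewrite (independent_pair_integral _ mY indYX mphi)//.
  pose psi (v : R) : \bar R := ((B < v <= x - B)%R%:R * tb (x - v))%:E.
  have mpsi : measurable_fun setT psi.
    apply/measurable_EFinP; apply: measurable_funM.
      have -> : (fun v => (B < v <= x - B)%R%:R : R) = \1_`]B, x - B].
        by apply/funext => v; rewrite indicE mem_setE in_itv.
      exact: measurable_indic.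
    apply: (measurableT_comp (tail_measurable F)); exact: measurable_funB.
  have psi0 v : (0 <= psi v)%E by rewrite lee_fin mulr_ge0// tail_ge0.
  have N1 : 0 <= N + 1 by rewrite addr_ge0.
  apply: (@le_trans _ _ (\int[P]_w ((N + 1)%:E * psi (X i w)))%E).
    apply: ge0_le_integral => //.
    - by move=> w _; exact: integral_ge0.
    - exact: (measurable_section_integral P _ mY mphi).
    - by apply: emeasurable_funM => //; exact: measurableT_comp mpsi _.
    move=> w _; rewrite /psi; case: (boolP (B < X i w <= x - B)) => h; last first.
      rewrite mul0r mule0 integral0_eq// => w' _.
      by rewrite /phi/= (negbTE h).
    rewrite mul1r -EFinM.
    apply: (@le_trans _ _ (P [set w' | (x - X i w < positive_sum s w')%R])); last first.
      by apply: MP; move/andP: h => [_]; lra.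
    rewrite -[X in P X]setIT -integral_indic//.
    apply: ge0_le_integral => //.
    - apply: measurableT_comp mphi _; exact: measurable_fun_pair.
    - exact/measurable_EFinP/measurable_indic.
    - move=> w' _; rewrite lee_fin indicE /phi/= h/=; case: ltP => [xw|_].
        by rewrite mem_set//= ltrBlDr.
      by rewrite ler0n.
  rewrite ge0_integralZl_EFin//; last exact: measurableT_comp mpsi _.
  rewrite (law_integral Xlaw)// EFinM; apply: lee_wpmul2l => //.
apply: (le_trans (le_measure _ _ _ sub)); rewrite ?inE//.
- apply: measurable_boolset; apply: measurable_fun_ltr => //.
  by apply: (@measurable_fun_gens _ _ _ _ _ X _ _ (i :: s)); exact: positive_sum_measurable.
- by do 2 apply: measurableU => //.
apply: (le_trans (measureU2 _ _ _)) => //.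
  exact: measurableU.
apply: (@le_trans _ _ (((N + e / 4) * tb (x - B))%:E + (tb (x - B))%:E + ((N + 1) * (e / (4 * (N + 1)) * tb x))%:E)%E).
  apply: leeD => //; apply: (le_trans (measureU2 _ _ _)) => //.
  by apply: leeD; [exact: hY|rewrite -(law_tail Xlaw i)].
rewrite -!EFinD lee_fin -(natr1 (size s)) -/N.
have -> : (N + 1) * (e / (4 * (N + 1)) * tb x) = e / 4 * tb x.
  by field; lra.
have tx := tail_ge0 F x.
have dE : dl * (N + 1 + e) = e / 4 by rewrite /dl; field; lra.
have h1 : (N + 1 + e / 4) * tb (x - B) <= (N + 1 + e / 4) * ((1 + dl) * tb x).
  by apply: ler_wpM2l => //; lra.
have h2 : dl * (N + 1 + e / 4) * tb x <= (e / 4) * tb x.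
  by rewrite -dE; apply: ler_wpM2r => //; apply: ler_wpM2l; lra.
by move: h1 h2 tx; set t := tb x; set u := tb (x - B) => h1 h2 tx; nra.
Unshelve. all: by end_near. Qed.

End positive_sum.

(** * Combinatorics of the genealogical tree *)

Section tree_combinatorics.
Implicit Type z : nat -> nat -> nat.

Local Open Scope nat_scope.

Lemma block_sum_leq z n i i' : i <= i' -> \sum_(k < i) z n k <= \sum_(k < i') z n k.
Proof.
move=> ii'; rewrite -!(big_mkord xpredT (fun k => z n k)).
by rewrite [X in _ <= X](big_cat_nat (leq0n i) ii')/= leq_addr.
Qed.

Lemma is_child_inj z n i i' j : is_child z n i j -> is_child z n i' j -> i = i'.
Proof.
move=> /andP[h1 h2] /andP[h3 h4]; case: (ltngtP i i') => // ii'.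
- by have := leq_trans h2 (leq_trans (block_sum_leq z n ii') h3); rewrite ltnn.
- by have := leq_trans h4 (leq_trans (block_sum_leq z n ii') h1); rewrite ltnn.
Qed.

Lemma child_lt_gen_size z n i j :
  i < gen_size z n -> is_child z n i j -> j < gen_size z n.+1.
Proof.
by move=> ig /andP[_ h]; apply: (leq_trans h); rewrite /=; exact: block_sum_leq.
Qed.

Lemma parent_exists z n j : j < gen_size z n.+1 ->
  exists2 i, i < gen_size z n & is_child z n i j.
Proof.
rewrite /=; elim: (gen_size z n) => [|N IH]; first by rewrite big_ord0.
case: (ltnP j (\sum_(k < N) z n k)) => [/IH[i iN ij] _|Nj jN].
  by exists i => //; exact: ltnW.
by exists N => //; rewrite /is_child Nj.
Qed.

Lemma tree_path_rcons z n i p j : tree_path z n i (rcons p j) =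
  tree_path z n i p && is_child z (n + size p) (last i p) j.
Proof.
elim: p n i => [|k p IH] n i /=; first by rewrite andbT addn0.
by rewrite IH andbA addSnnS.
Qed.

Lemma tree_path_nth_lt z n i p k : i < gen_size z n -> tree_path z n i p ->
  k < size p -> nth 0 p k < gen_size z (n + k.+1).
Proof.
elim: p n i k => [//|j p IH] n i k ig /= /andP[ij pp] kp.
have jg := child_lt_gen_size ig ij.
case: k kp => [_|k kp] /=; first by rewrite addn1.
by rewrite -addSnnS; exact: IH pp _.
Qed.

Lemma path_to_vertex z m j : j < gen_size z m ->
  exists p, [/\ root_path z p, size p = m & last 0 p = j].
Proof.
elim: m j => [|m IH] j; first by rewrite /= ltnS leqn0 => /eqP ->; exists [::].
move=> /parent_exists[i /IH[p [pp sp lp]] ij]; exists (rcons p j).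
by rewrite /root_path tree_path_rcons size_rcons last_rcons sp add0n lp ij andbT.
Qed.

Lemma root_path_inj z p q : root_path z p -> root_path z q -> size p = size q ->
  last 0 p = last 0 q -> p = q.
Proof.
rewrite /root_path.
elim/last_ind: p q => [|p i IH] q; first by case: q.
case/lastP: q => [|q j]; first by rewrite size_rcons.
rewrite !tree_path_rcons !size_rcons !last_rcons !add0n => /andP[pp ip] /andP[pq jq].
move=> [] spq ij; rewrite ij; congr rcons; apply: IH => //.
by apply: (is_child_inj (z := z) (n := size p) (j := j)); rewrite -?ij// spq ij.
Qed.

(** A root path is determined by its end vertex, so there are as many root paths of length [m] as
    vertices in generation [m]. *)
Lemma root_path_list z m : exists L : seq (seq nat),
  [/\ size L = gen_size z m, forall q, q \in L -> size q = m &
      forall q, root_path z q -> size q = m -> q \in L].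
Proof.
have [anc ancP] : exists anc : nat -> seq nat, forall j, j < gen_size z m ->
    [/\ root_path z (anc j), size (anc j) = m & last 0 (anc j) = j].
  have [anc ancP] := @choice _ _ (fun j p => j < gen_size z m ->
    [/\ root_path z p, size p = m & last 0 p = j])
    (fun j => match boolP (j < gen_size z m) with
       | AltTrue h => let: ex_intro p hp := path_to_vertex h in
           ex_intro _ p (fun=> hp)
       | AltFalse h => ex_intro _ [::] (fun h' => False_ind _ (negP h h')) end).
  by exists anc.
exists (map anc (iota 0 (gen_size z m))); split; first by rewrite size_map size_iota.
  move=> q /mapP[j]; rewrite mem_iota add0n => /andP[_ jg] ->.
  by case: (ancP _ jg).
move=> q pq sq; have jg : last 0 q < gen_size z m.
  case/lastP: q pq sq => [_ <-//|q j]; rewrite last_rcons => pq sq.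
  have := tree_path_nth_lt (k := size q) (isT : 0 < gen_size z 0) pq.
  by rewrite size_rcons nth_rcons ltnn eqxx add0n -sq size_rcons; apply.
have [pa sa la] := ancP _ jg.
apply/mapP; exists (last 0 q); first by rewrite mem_iota.
by apply: (root_path_inj pq pa); rewrite ?sa ?la.
Qed.

Lemma root_path_extend z p m : (forall n j, 0 < z n j) -> root_path z p ->
  size p <= m -> exists q, [/\ root_path z q, size q = m & take (size p) q = p].
Proof.
move=> z0 pp; elim: m => [|m IH] sp.
  exists [::]; split => //; move: sp; rewrite leqn0 size_eq0 => /eqP ->//.
move: sp; rewrite leq_eqVlt => /orP[/eqP sp|/IH[q [pq sq tq]]].
  by exists p; rewrite take_size.
exists (rcons q (\sum_(k < last 0 q) z m k)); split.
- rewrite /root_path tree_path_rcons -/(root_path z q) pq/= add0n sq.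
  by rewrite /is_child leqnn big_ord_recr/= -[X in X < _]addn0 ltn_add2l z0.
- by rewrite size_rcons sq.
- rewrite -cats1 takel_cat//; rewrite -tq size_take sq.
  by case: ltnP => //; exact: ltnW.
Qed.

(** The edges of a root path, as pairs of an end vertex and its generation, in the order of the indices
    of the increments. *)
Definition path_edges (p : seq nat) : seq (nat * nat) := zip p (iota 1 (size p)).

(** The edges of the tree up to generation [m], as pairs of an end vertex and its generation. *)
Definition tree_edges z m : seq (nat * nat) :=
  [seq (j, k) | k <- iota 1 m, j <- iota 0 (gen_size z k)].

Lemma size_path_edges p : size (path_edges p) = size p.
Proof. by rewrite size_zip size_iota minnn. Qed.

Lemma nth_path_edges e0 p k : k < size p ->
  nth e0 (path_edges p) k = (nth 0 p k, k.+1).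
Proof.
case: e0 => a b kp; rewrite nth_zip ?size_iota// nth_iota// add1n.
by congr pair; exact: set_nth_default.
Qed.

Lemma path_edges_uniq p : uniq (path_edges p).
Proof.
apply: (@map_uniq _ _ snd); rewrite -/(unzip2 _) unzip2_zip ?iota_uniq//.
by rewrite size_iota.
Qed.

Lemma path_edges_take k p : path_edges (take k p) = take k (path_edges p).
Proof.
have [kp|pk] := leqP k (size p); last by rewrite !take_oversize ?size_path_edges 1?ltnW.
apply: (@eq_from_nth _ (0, 0)).
  by rewrite size_path_edges !size_takel// size_path_edges.
move=> i; rewrite size_path_edges size_takel// => ik.
by rewrite nth_path_edges ?size_takel// !nth_take// nth_path_edges// (leq_trans ik).
Qed.

Lemma tree_edgesP z m j k :
  reflect (0 < k <= m /\ j < gen_size z k) ((j, k) \in tree_edges z m).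
Proof.
apply: (iffP allpairsPdep) => [[k' [j' [h1 h2 [-> ->]]]]|[km jk]].
  by move: h1 h2; rewrite !mem_iota add1n ltnS add0n => -> /andP[].
by exists k, j; rewrite !mem_iota add1n ltnS.
Qed.

Lemma tree_edges_uniq z m : uniq (tree_edges z m).
Proof.
apply: allpairs_uniq_dep; [exact: iota_uniq|by move=> k _; exact: iota_uniq|].
by move=> [k j] [k' j'] _ _ /= [-> ->].
Qed.

Lemma size_tree_edges z m : size (tree_edges z m) = \sum_(1 <= k < m.+1) gen_size z k.
Proof.
rewrite size_allpairs_dep sumnE big_map /index_iota subn1/=.
by apply: eq_bigr => k _; rewrite size_iota.
Qed.

Lemma path_edges_sub z m p : root_path z p -> size p <= m ->
  {subset path_edges p <= tree_edges z m}.
Proof.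
move=> pp pm [j k] /(nthP (0, 0))[i]; rewrite size_path_edges => ip.
rewrite nth_path_edges// => -[<- <-]; apply/tree_edgesP.
split; first by rewrite /= (leq_trans ip).
by have := tree_path_nth_lt (isT : 0 < gen_size z 0) pp ip; rewrite add0n.
Qed.

Lemma tree_edge_on_path z m e : e \in tree_edges z m ->
  exists p, [/\ root_path z p, size p <= m & e \in path_edges p].
Proof.
case: e => j k /tree_edgesP[/andP[k0 km] /path_to_vertex[p [pp sp lp]]].
exists p; split => //; first by rewrite sp.
have pk : (k.-1 < size p) by rewrite sp prednK.
apply/(nthP (0, 0)); exists k.-1; first by rewrite size_path_edges.
by rewrite nth_path_edges// prednK// -lp -nth_last sp.
Qed.

Lemma gen_size_gt0 z n : (forall n j, 0 < z n j) -> 0 < gen_size z n.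
Proof.
move=> z0; elim: n => //= n IH; case: (gen_size z n) IH => // N _.
by rewrite big_ord_recl ltn_addr.
Qed.

Lemma gen_size_leq z n m : (forall n j, 0 < z n j) -> n <= m ->
  gen_size z n <= gen_size z m.
Proof.
move=> z0; elim: m => [|m IH]; first by rewrite leqn0 => /eqP ->.
rewrite leq_eqVlt => /orP[/eqP -> //|/IH h]; apply: (leq_trans h).
rewrite /= -[X in X <= _]card_ord -sum1_card; exact: leq_sum.
Qed.

Lemma sum_gen_size_le z m : (forall n j, 0 < z n j) ->
  \sum_(1 <= k < m.+1) gen_size z k <= m * gen_size z m.
Proof.
move=> z0; have -> : m * gen_size z m = \sum_(1 <= k < m.+1) gen_size z m.
  by rewrite sum_nat_const_nat subn1.
rewrite !big_nat; apply: leq_sum => k /andP[_ km].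
exact: gen_size_leq.
Qed.

End tree_combinatorics.

(** * The maximum over a fixed tree *)

Section path_sums.
Context (R : realType) (z : nat -> nat -> nat) (xx : nat -> nat -> R) (c : R).

Lemma path_sum_edges p : path_sum xx p = \sum_(e <- path_edges p) xx e.1 e.2.
Proof.
rewrite (big_nth (0, 0)%N) size_path_edges big_mkord /path_sum.
by apply: eq_bigr => k _; rewrite nth_path_edges.
Qed.

Lemma shifted_sum_edges p :
  path_sum xx p - c * (size p)%:R = \sum_(e <- path_edges p) (xx e.1 e.2 - c).
Proof.
rewrite path_sum_edges sumrB; congr (_ - _).
by rewrite big_const_seq count_predT size_path_edges iter_addr addr0 mulr_natr.
Qed.

Lemma max_shifted_sum_gtP m x : x < max_shifted_sum z xx c m <->
  exists p, [/\ root_path z p, (size p <= m)%N & x < path_sum xx p - c * (size p)%:R].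
Proof.
have [[p /= [pp pm] <-] ub] := max_shifted_sumP z xx c m.
split=> [h|[q [pq qm h]]]; first by exists p.
by apply: (lt_le_trans h); apply: ub; exists q.
Qed.

Lemma max_shifted_sum_lt_pos m x : 0 <= c -> x < max_shifted_sum z xx c m ->
  x < \sum_(e <- tree_edges z m) Num.max 0 (xx e.1 e.2).
Proof.
move=> c0 /max_shifted_sum_gtP[p [pp pm h]]; apply: (lt_le_trans h).
apply: (@le_trans _ _ (path_sum xx p)); first by rewrite gerBl mulr_ge0.
rewrite path_sum_edges.
apply: (@le_trans _ _ (\sum_(e <- path_edges p) Num.max 0 (xx e.1 e.2))).
  by apply: ler_sum => e _; rewrite le_max lexx orbT.
rewrite [leRHS](bigID (fun e => e \in path_edges p))/=.
rewrite -[X in _ <= X + _]big_filter [X in _ <= X + _](perm_big (path_edges p)); last first.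
  apply: uniq_perm; rewrite ?filter_uniq ?tree_edges_uniq ?path_edges_uniq// => e.
  by rewrite mem_filter andb_idr//; exact: path_edges_sub.
by rewrite lerDl; apply: sumr_ge0 => e _; rewrite le_max lexx.
Qed.

(** In a tree without dead ends, only the root paths of maximal length matter. *)
Lemma max_shifted_sum_lt_leaf (L : seq (seq nat)) m x : (forall n j, (0 < z n j)%N) ->
  (forall q, root_path z q -> size q = m -> q \in L) ->
  x < max_shifted_sum z xx c m ->
  exists2 q, q \in L & exists k,
    x < \sum_(e <- take k (path_edges q)) (xx e.1 e.2 - c).
Proof.
move=> z0 LP /max_shifted_sum_gtP[p [pp pm h]].
have [q [pq qm tq]] := root_path_extend z0 pp pm.
exists q; first exact: LP.
by exists (size p); rewrite -path_edges_take tq -shifted_sum_edges.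
Qed.

(** One large increment, on any edge, makes the maximum large if no other increment is below [- a]. *)
Lemma max_shifted_sum_gt_edge m x a e : 0 <= a -> 0 <= c -> e \in tree_edges z m ->
  (forall e', e' \in tree_edges z m -> e' != e -> - a <= xx e'.1 e'.2) ->
  x + m%:R * (a + c) < xx e.1 e.2 -> x < max_shifted_sum z xx c m.
Proof.
move=> a0 c0 es others xe; apply/max_shifted_sum_gtP.
have [p [pp pm ep]] := tree_edge_on_path es; exists p; split => //.
rewrite path_sum_edges (bigD1_seq e)//=; last exact: path_edges_uniq.
have h1 : - (m%:R * a) <= \sum_(e' <- path_edges p | e' != e) xx e'.1 e'.2.
  apply: (@le_trans _ _ (\sum_(e' <- path_edges p | e' != e) (- a))).
    rewrite big_const_seq iter_addr addr0 mulNrn lerN2 -[X in X <= _]mulr_natl ler_wpM2r// ler_nat.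
    apply: (leq_trans (count_size _ _)).
    by rewrite size_path_edges.
  rewrite big_seq_cond [leRHS]big_seq_cond; apply: ler_sum => e' /andP[e'p e'e].
  by apply: others => //; exact: path_edges_sub pp pm _ e'p.
have h2 : c * (size p)%:R <= m%:R * c by rewrite mulrC ler_wpM2r// ler_nat.
by rewrite mulrDr in xe; lra.
Qed.

End path_sums.

Section fixed_tree.
Context d (T : measurableType d) (R : realType) (P : probability T R).
Context (xi : nat -> nat -> {RV P >-> R}) (F : probability R R).
Let X (ik : nat * nat) := xi ik.1 ik.2.
Hypothesis Xindep : independent_RVs X.
Hypothesis xi_law : forall i k, has_law (xi i k) F.
Hypothesis Fint : F.-integrable setT (EFin \o (@id R)).
Hypothesis Fmean : (\int[F]_v v%:E = 0)%E.
Hypothesis Fsse : strong_subexponential F.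
Variable c : R.
Hypothesis c0 : 0 < c.
Local Notation tb := (tail F).
Local Notation M z m w := (max_shifted_sum z (fun i k => xi i k w) c m).

Let Xlaw i : has_law (X i) F. Proof. exact: xi_law. Qed.

Lemma max_shifted_sum_set z m x : [set w | x < M z m w] =
  \bigcup_(p in [set p | root_path z p /\ (size p <= m)%N])
    [set w | x < \sum_(e <- path_edges p) (X e w - c)].
Proof.
apply/seteqP; split => w /=.
  move=> /max_shifted_sum_gtP[p [pp pm h]]; exists p => //.
  by rewrite /= -[ltRHS](shifted_sum_edges (fun i k => xi i k w)).
move=> [p [pp pm] h]; apply/max_shifted_sum_gtP; exists p; split => //.
by rewrite shifted_sum_edges.
Qed.

Lemma measurable_max_shifted_sum z m x : measurable [set w | x < M z m w].
Proof.
rewrite max_shifted_sum_set; apply: fin_bigcup_measurable => [|p _].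
  exact: finite_tree_paths.
apply: measurable_boolset; apply: measurable_fun_ltr => //.
apply: measurable_sum => e; exact: measurable_funB.
Qed.

(** Union bound over the root paths of maximal length, uniform in the tree. For [m > 0] the factor
    [m + 1] of a single path is absorbed in [2 * m]; for [m = 0] the maximum is 0. *)
Lemma fixed_tree_bound : exists C x0 : R, [/\ 0 <= C, 0 <= x0 &
  forall z m x, (forall n j, (0 < z n j)%N) -> x0 <= x ->
  (P [set w | (x < M z m w)%R] <= ((m * gen_size z m)%:R * C * tb x)%:E)%E].
Proof.
have [C [x0 [C0 x00 hC]]] := frozen_walk_tail Xindep Xlaw Fint Fmean Fsse c0.
exists (2 * C), x0; split=> [|//|]; first by rewrite mulr_ge0.
move=> z [|m] x z0 x0x; have x_ge0 := le_trans x00 x0x.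
  rewrite mul0n !mul0r (_ : mkset _ = set0) ?measure0//.
  rewrite -subset0 => w /= /max_shifted_sum_gtP[p [_]].
  rewrite leqn0 size_eq0 => /eqP -> /=.
  by rewrite /path_sum big_ord0 mulr0 subr0 ltNge x_ge0.
have [L [sL Lsz LP]] := root_path_list z m.+1.
pose W q := [set w | x < frozen_walk X c x (path_edges q) w].
have mW q : measurable (W q).
  apply: measurable_boolset; apply: measurable_fun_ltr => //.
  apply: (@measurable_fun_gens _ _ _ _ _ X _ _ (path_edges q)).
  exact: frozen_walk_measurable.
have sub : [set w | x < M z m.+1 w] `<=` \big[setU/set0]_(q <- L) W q.
  move=> w /= /(max_shifted_sum_lt_leaf z0 LP)[q qL [k hk]].
  rewrite -bigcup_seq; exists q => //.
  exact: frozen_walk_gt hk x_ge0.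
have mU : measurable (\big[setU/set0]_(q <- L) W q) by exact: bigsetU_measurable.
apply: (le_trans (le_measure _ _ _ sub)); rewrite ?inE//.
  exact: measurable_max_shifted_sum.
apply: (@le_trans _ _ (\sum_(q <- L) P (W q))%E).
  elim: L {sL Lsz LP sub mU} => [|q L IH]; first by rewrite !big_nil measure0.
  rewrite !big_cons; apply: (le_trans (measureU2 _ _ _)) => //.
    exact: bigsetU_measurable.
  exact: leeD.
apply: (@le_trans _ _ (\sum_(q <- L) (m.+2%:R * C * tb x)%:E)%E).
  rewrite big_seq [leRHS]big_seq; apply: lee_sum => q qL.
  by rewrite (le_trans (hC _ _ x0x (path_edges_uniq q)))// size_path_edges Lsz.
rewrite sumEFin lee_fin big_const_seq count_predT sL iter_addr addr0.
set g := gen_size z m.+1.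
have -> : m.+2%:R * C * tb x *+ g = (m.+2 * g)%:R * (C * tb x).
  by rewrite -[LHS]mulr_natr natrM; ring.
have -> : (m.+1 * g)%:R * (2 * C) * tb x = (m.+1 * 2 * g)%:R * (C * tb x).
  by rewrite !natrM; ring.
apply: ler_wpM2r; first by rewrite mulr_ge0 ?tail_ge0.
by rewrite ler_nat leq_mul2r muln2 -addnn addSnnS leq_addl orbT.
Qed.

(** The maximum is at most the sum of the positive parts of all the increments. *)
Lemma fixed_tree_upper z m e : 0 < e ->
  \forall x \near +oo, (P [set w | (x < M z m w)%R] <=
     (((size (tree_edges z m))%:R + e) * tb x)%:E)%E.
Proof.
move=> e0; have := positive_sum_tail Xindep Xlaw Fsse (tree_edges_uniq z m) e0.
apply: filterS => x; apply: le_trans; apply: le_measure; rewrite ?inE//.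
- exact: measurable_max_shifted_sum.
- apply: measurable_boolset; apply: measurable_fun_ltr => //.
  apply: (@measurable_fun_gens _ _ _ _ _ X _ _ (tree_edges z m)).
  exact: positive_sum_measurable.
- by move=> w /=; exact: max_shifted_sum_lt_pos (ltW c0).
Qed.

(** Finitely many increments are simultaneously bounded with probability close to 1. *)
Lemma small_family (s : seq (nat * nat)) e : 0 < e -> exists a : nat,
  1 - e <= fine (P [set w | forall i, i \in s -> `|X i w| <= a%:R]).
Proof.
move=> e0; pose G n := [set w | forall i, i \in s -> `|X i w| <= n%:R].
have mG n : measurable (G n).
  rewrite (_ : G n = \bigcap_(i in [set` s]) [set w | `|X i w| <= n%:R])//.
  apply: fin_bigcap_measurable => // i _; apply: measurable_boolset.
  by apply: measurable_fun_ler => //; exact: measurableT_comp.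
have ndG : nondecreasing_seq G.
  move=> n k nk; apply/subsetPset => w Gw i /Gw /le_trans; apply.
  by rewrite ler_nat.
have UG : \bigcup_n G n = setT.
  apply/seteqP; split => // w _.
  exists (Num.truncn (\sum_(i <- s) `|X i w|)).+1 => // i js.
  apply: (@le_trans _ _ (\sum_(i <- s) `|X i w|)); last exact/ltW/truncnS_gt.
  rewrite (big_rem i)//= lerDl; exact: sumr_ge0.
have cvG : P (G n) @[n --> \oo] --> 1%E.
  rewrite -(probability_setT P) -UG; apply: nondecreasing_cvg_mu => //.
  by rewrite UG.
move: cvG => /fine_cvgP[_ /cvgrPdist_le /(_ _ e0)[n _ /(_ n (leqnn n))/=]].
by rewrite ler_norml => /andP[_ h]; exists n; rewrite lerBlDr -lerBlDl.
Qed.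

(** The events that a given edge carries a jump above [x + h], all the others staying in [- a, a], are
    disjoint for large [x] and each of them makes the maximum exceed [x]. *)
Lemma fixed_tree_lower z m e : 0 < e ->
  \forall x \near +oo, 
    ((size (tree_edges z m))%:R - e) * tb x <= fine (P [set w | (x < M z m w)%R]).
Proof.
move=> e0; set s := tree_edges z m; set N : R := (size s)%:R.
have N0 : 0 <= N by rewrite ler0n.
pose dl := e / (2 * N + 1).
have dl0 : 0 < dl by rewrite divr_gt0// ltr_wpDl// mulr_ge0.
have [a aP] := small_family s dl0.
pose h := m%:R * (a%:R + c).
have h0 : 0 <= h by rewrite mulr_ge0// addr_ge0// ltW.
pose G (t : seq (nat * nat)) := [set w | forall i, i \in t -> `|X i w| <= a%:R].
pose A (x : R) (i : nat * nat) := G (rem i s) `&` [set w | x + h < X i w].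
have us := tree_edges_uniq z m.
have sG t : <<s gens X t >> (G t).
  suff : measurable (G t : set (g_sigma_algebraType (gens X t))) by [].
  rewrite (_ : G t = \bigcap_(i in [set` t]) [set w | `|X i w| <= a%:R])//.
  apply: fin_bigcap_measurable => // i it; apply: measurable_boolset.
  apply: measurable_fun_ler => //; apply: measurableT_comp => //.
  exact: measurable_gens.
have mG t : measurable (G t) by exact: sigma_gens_measurable (sG t).
have mA x i : measurable (A x i).
  apply: measurableI => //; apply: measurable_boolset.
  exact: measurable_fun_ltr.
have [M' [_ M'P]] := long_tailed Fsse h0 dl0.
near=> x.
have lt : tb x <= (1 + dl) * tb (x + h).
  have := M'P (x + h); rewrite addrK; apply.
  have : M' < x by near: x; apply: nbhs_pinfty_gt; exact: num_real.
  by lra.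
have xa : a%:R < x + h.
  have : a%:R < x by near: x; apply: nbhs_pinfty_gt; exact: num_real.
  by lra.
have trivA : trivIset [set` s] (A x).
  move=> i j /= si sj [w [[_ /= Xi] [Gj _]]]; apply/eqP; apply: contraT => ij.
  have : i \in rem j s by rewrite mem_rem_uniq// inE ij.
  move=> /Gj; rewrite leNgt => /negP[]; rewrite (lt_trans xa)// (lt_le_trans Xi)//.
  exact: ler_norm.
have sub : \bigcup_(i in [set` s]) A x i `<=` [set w | x < M z m w].
  move=> w [i /= si [Gi Xi]].
  apply: (max_shifted_sum_gt_edge (a := a%:R) (e := i)) => //; first exact: ltW.
  move=> j sj ji; have : j \in rem i s by rewrite mem_rem_uniq// inE ji.
  by move=> /Gi; rewrite ler_norml => /andP[].
have PG t : {subset t <= s} -> 1 - dl <= fine (P (G t)).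
  move=> ts; apply: (le_trans aP); apply: fine_le; rewrite ?fin_num_measure//.
    exact: (mG s).
  apply: le_measure; rewrite ?inE//; first exact: (mG s).
  by move=> w Gs i /ts; exact: Gs.
have PA i : i \in s -> (((1 - dl) * tb (x + h))%:E <= P (A x i))%E.
  move=> si; have irem : i \notin rem i s by rewrite mem_rem_uniq// inE eqxx.
  have -> : A x i = G (rem i s) `&` X i @^-1` `]x + h, +oo[.
    by congr (_ `&` _); apply/seteqP; split => w /=; rewrite in_itv/= andbT.
  rewrite (independent_past Xindep _ irem (sG _))// ?rem_uniq//.
  have -> : P (X i @^-1` `]x + h, +oo[) = (tb (x + h))%:E.
    by rewrite -(law_tail Xlaw i); congr (P _); apply/seteqP; split => w /=; rewrite in_itv/= andbT.
  rewrite EFinM; apply: lee_wpmul2r; first by rewrite lee_fin tail_ge0.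
  rewrite -[leRHS]fineK ?fin_num_measure// lee_fin; apply: PG.
  by move=> j; exact: mem_rem.
have mM : measurable [set w | x < M z m w] by exact: measurable_max_shifted_sum.
have low : (1 - dl) * tb (x + h) * N <= fine (P [set w | (x < M z m w)%R]).
  rewrite -lee_fin fineK ?fin_num_measure//.
  apply: (@le_trans _ _ (P (\bigcup_(i in [set` s]) A x i))); last first.
    by apply: le_measure; rewrite ?inE//; apply: fin_bigcup_measurable.
  rewrite measure_fin_bigcup//; last exact: finite_seq.
  have -> : (\sum_(i \in [set` s]) P (A x i) = \sum_(i <- s) P (A x i))%R.
    by apply/esym; exact: fsbig_seq us.
  apply: (@le_trans _ _ (\sum_(i <- s) ((1 - dl) * tb (x + h))%:E)%E).
    rewrite sumEFin lee_fin big_const_seq count_predT iter_addr addr0.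
    by rewrite -[leRHS]mulr_natr.
  by rewrite big_seq [leRHS]big_seq; apply: lee_sum => i; exact: PA.
have eE : e = 2 * N * dl + dl by rewrite /dl; field; lra.
have tx := tail_ge0 F x; have txh := tail_ge0 F (x + h).
have hta : tb (x + h) <= tb x by apply: tail_nonincreasing; lra.
have [dl1|dl1] := ltP dl 1; last first.
  apply: (@le_trans _ _ 0); last exact: fine_ge0.
  by rewrite mulr_le0_ge0// eE; nra.
apply: le_trans low; rewrite eE.
move: lt tx txh hta; set t := tb x; set u := tb (x + h) => lt tx txh hta.
have h1 : (1 - dl) * t <= u.
  by have : dl * u <= dl * t; [rewrite ler_wpM2l// ltW|lra].
have h2 : (1 - dl) * ((1 - dl) * t) * N <= (1 - dl) * u * N.
  by rewrite ler_wpM2r// ler_wpM2l//; lra.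
apply: le_trans h2.
have dl0' := ltW dl0; have h3 : 0 <= dl * dl * t * N.
  exact: mulr_ge0 (mulr_ge0 (mulr_ge0 dl0' dl0') tx) N0.
have h4 : 0 <= dl * t := mulr_ge0 dl0' tx.
have -> : (1 - dl) * ((1 - dl) * t) * N = (N - (2 * N * dl + dl)) * t + (dl * dl * t * N + dl * t).
  by ring.
by rewrite lerDl addr_ge0.
Unshelve. all: by end_near. Qed.

End fixed_tree.

(** * Averaging over the random tree *)

Section random_tree_measurability.
Context d (T : measurableType d).

Lemma measurable_random_index d' (U : measurableType d') (N : T -> nat)
    (f : nat -> T -> U) : measurable_fun setT N ->
  (forall k, measurable_fun setT (f k)) -> measurable_fun setT (fun w => f (N w) w).
Proof.
move=> mN mf _ Y mY; rewrite setTI.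
rewrite (_ : _ @^-1` Y = \bigcup_k (N @^-1` [set k] `&` f k @^-1` Y)).
  apply: bigcupT_measurable => k; apply: measurableI.
    by rewrite -[X in measurable X]setTI; exact: mN.
  by rewrite -[X in measurable X]setTI; exact: mf.
apply/seteqP; split => w /=; first by move=> fY; exists (N w).
by move=> [k _ [/= -> ]].
Qed.

Lemma measurable_sum_nat (I : Type) (s : seq I) (f : I -> T -> nat) :
  (forall i, measurable_fun setT (f i)) ->
  measurable_fun setT (fun w => \sum_(i <- s) f i w)%N.
Proof.
move=> mf; elim: s => [|i s IH].
  rewrite (_ : (fun w => _) = cst 0%N); first exact: measurable_cst.
  by apply/funext => w; rewrite big_nil.
rewrite (_ : (fun w => _) = fun w => (f i w + \sum_(j <- s) f j w)%N).
  exact: measurable_fun_addn.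
by apply/funext => w; rewrite big_cons.
Qed.

Variable zeta : nat -> nat -> T -> nat.
Hypothesis mzeta : forall n j, measurable_fun setT (zeta n j).
Local Notation off w := (fun n j => zeta n j w).

Lemma measurable_gen_size n : measurable_fun setT (fun w => gen_size (off w) n).
Proof.
elim: n => //= n IH.
apply: (measurable_random_index (f := fun k w => (\sum_(j < k) zeta n j w)%N)) => // k.
exact: measurable_sum_nat.
Qed.

Lemma measurable_is_child n i j : measurable_fun setT (fun w => is_child (off w) n i j).
Proof.
by apply: measurable_and; [apply: measurable_fun_leq|apply: measurable_fun_ltn] => //;
  exact: measurable_sum_nat.
Qed.

Lemma measurable_tree_path n i p : measurable_fun setT (fun w => tree_path (off w) n i p).
Proof.
elim: p n i => //= j p IH n i; apply: measurable_and => //.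
exact: measurable_is_child.
Qed.

End random_tree_measurability.

Section randomization.
Context d (T : measurableType d) (R : realType) (P : probability T R).
Context (zeta : nat -> nat -> {RV P >-> nat}) (xi : nat -> nat -> {RV P >-> R}).
Context (mu : {RV P >-> nat}).
Hypothesis indep : independent P
  (sigma_family (fun ik : nat * nat => xi ik.1 ik.2))
  <<s g_sigma_algebra_preimage mu `|`
      sigma_family (fun nj : nat * nat => zeta nj.1 nj.2) >>.
Variable c : R.

Let G1 : set_system T := g_sigma_algebra_preimage mu `|`
  sigma_family (fun nj : nat * nat => zeta nj.1 nj.2).
Let G2 : set_system T := \bigcup_ik g_sigma_algebra_preimage (xi ik.1 ik.2).

(** The probability that the maximum exceeds [x] when the tree and the horizon are frozen at
    their values in [w]. *)
Definition frozen_tree_prob x w : \bar R :=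
  P [set w' | x < max_shifted_sum (offspring zeta w) (fun i k => xi i k w') c (mu w)].

Let mzeta n j : measurable_fun setT (zeta n j : g_sigma_algebraType G1 -> nat).
Proof.
move=> _ B mB; apply: sub_sigma_algebra; right; apply: sub_sigma_algebra.
by exists (n, j) => //; exists B.
Qed.

Let mmu : measurable_fun setT (mu : g_sigma_algebraType G1 -> nat).
Proof. by move=> _ B mB; apply: sub_sigma_algebra; left; exists B. Qed.

Let mxi i k : measurable_fun setT (xi i k : g_sigma_algebraType G2 -> R).
Proof. by move=> _ B mB; apply: sub_sigma_algebra; exists (i, k) => //; exists B. Qed.

Let sub_G2 A : <<s G2 >> A -> measurable A.
Proof.
apply: smallest_sub; first exact: sigma_algebra_measurable.
by move=> Y [ik _ [B mB <-]]; rewrite setTI; exact: measurable_funPTI.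
Qed.

Let sub_G1 A : <<s G1 >> A -> measurable A.
Proof.
apply: smallest_sub; first exact: sigma_algebra_measurable.
move=> Y [[B mB <-]|]; first by rewrite setTI; exact: measurable_funPTI.
apply: smallest_sub; first exact: sigma_algebra_measurable.
by move=> Z [nj _ [B mB <-]]; rewrite setTI; exact: measurable_funPTI.
Qed.

(** The identity maps to the two independent sigma-algebras, seen as random elements. *)
Let id1 : T -> g_sigma_algebraType G1 := id.
Let id2 : T -> g_sigma_algebraType G2 := id.

Let mid1 : measurable_fun setT id1.
Proof. by move=> _ B mB; rewrite setTI; exact: sub_G1. Qed.

Let mid2 : measurable_fun setT id2.
Proof. by move=> _ B mB; rewrite setTI; exact: sub_G2. Qed.

(** The pairs of sample points [(w, w')] such that the tree and the horizon of [w] with the increments of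
    [w'] give a maximum above [x]. It is a countable union, over all the sequences of vertices, of
    products of a tree event and an increment event. *)
Let excess x : set (g_sigma_algebraType G1 * g_sigma_algebraType G2) :=
  \bigcup_(p : seq nat)
    ([set w | root_path (offspring zeta w) p && (size p <= mu w)%N] `*`
     [set w | x < \sum_(e <- path_edges p) (xi e.1 e.2 w - c)]).

Let excessP x w w' : excess x (w, w') <->
  x < max_shifted_sum (offspring zeta w) (fun i k => xi i k w') c (mu w).
Proof.
rewrite (max_shifted_sum_gtP _ (fun i k => xi i k w')); split.
  by move=> [p _ [/= /andP[pp pm] h]]; exists p; rewrite shifted_sum_edges.
move=> [p [pp pm]]; rewrite shifted_sum_edges => h.
by exists p => //; split => //=; rewrite pp.
Qed.

Let measurable_excess x : measurable (excess x).
Proof.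
apply: countable_bigcupT_measurable => // p; apply: measurableX.
  apply: measurable_boolset; apply: measurable_and.
    apply: (@measurable_tree_path _ (g_sigma_algebraType G1)
      (fun n j => (zeta n j : T -> nat))) => n j.
    exact: mzeta.
  exact: measurable_fun_leq.
apply: measurable_boolset; apply: measurable_fun_ltr => //.
by apply: measurable_sum => e; exact: measurable_funB.
Qed.

Let phi x (p : g_sigma_algebraType G1 * g_sigma_algebraType G2) : \bar R :=
  (\1_(excess x) p)%:E.

Let mphi x : measurable_fun setT (phi x).
Proof. by apply/measurable_EFinP; apply: measurable_indic; exact: measurable_excess. Qed.

Let phi0 x p : (0 <= phi x p)%E. Proof. by rewrite lee_fin. Qed.

Lemma measurable_excess_section x w : measurable
  [set w' | x < max_shifted_sum (offspring zeta w) (fun i k => xi i k w') c (mu w)].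
Proof. exact: measurable_max_shifted_sum. Qed.

Let frozen_tree_probE x w : frozen_tree_prob x w = (\int[P]_w' phi x (w, w'))%E.
Proof.
rewrite /frozen_tree_prob -[X in P X]setIT -integral_indic//; last first.
  exact: measurable_excess_section.
apply: eq_integral => w' _; rewrite /phi !indicE; congr (nat_of_bool _)%:R%:E.
by apply/idP/idP => /set_mem/excessP h; apply/mem_set => //; exact/excessP.
Qed.

Lemma measurable_frozen_tree_prob x : measurable_fun setT (frozen_tree_prob x).
Proof.
rewrite (_ : frozen_tree_prob x = fun w => \int[P]_w' phi x (id1 w, id2 w'))%E.
  exact: (measurable_section_integral P mid1 mid2 (mphi x)).
by apply/funext => w; exact: frozen_tree_probE.
Qed.

Lemma measurable_Rmax x : measurable [set w | x < Rmax zeta mu xi c w].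
Proof.
rewrite (_ : [set w | _] = (fun w => (id1 w, id2 w)) @^-1` excess x).
  rewrite -[X in measurable X]setTI.
  exact: (measurable_fun_pair mid1 mid2).
by apply/seteqP; split => w /= /excessP.
Qed.

(** Averaging over the tree and the horizon, which are independent of the increments. *)
Lemma Rmax_tailE x :
  P [set w | x < Rmax zeta mu xi c w] = (\int[P]_w frozen_tree_prob x w)%E.
Proof.
transitivity (\int[P]_w phi x (id1 w, id2 w))%E.
  rewrite -[X in P X]setIT -integral_indic//; last exact: measurable_Rmax.
  apply: eq_integral => w _; rewrite /phi !indicE; congr (nat_of_bool _)%:R%:E.
  by apply/idP/idP => /set_mem/excessP h; apply/mem_set => //; exact/excessP.
rewrite (independent_pair_integral mid1 mid2 _ (mphi x))//.
  by apply: eq_integral => w _; rewrite frozen_tree_probE.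
by move=> A B mA mB; rewrite setIC muleC; exact: indep.
Qed.

End randomization.

(** * Dominated convergence and asymptotic equivalence *)

Section asymptotics_tools.
Context (R : realType).

(** Lebesgue's dominated convergence theorem along [x --> +oo]. *)
Lemma dominated_cvg_pinfty d (T : measurableType d) (P : probability T R)
  (f : R -> T -> R) (h g : T -> R) (x0 : R) :
  (forall x, x0 <= x -> measurable_fun setT (f x)) -> measurable_fun setT h ->
  P.-integrable setT (EFin \o g) ->
  {ae P, forall w, forall x, x0 <= x -> `|f x w| <= g w} ->
  {ae P, forall w, f x w @[x --> +oo] --> h w} ->
  fine (\int[P]_w (f x w)%:E)%E @[x --> +oo] --> fine (\int[P]_w (h w)%:E)%E.
Proof.
move=> mf mh ig fg fh.
(* The domination only holds from [x0] on. *)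
pose f' x := f (Num.max x x0).
have f'f : \forall x \near +oo, fine (\int[P]_w (f' x w)%:E)%E = fine (\int[P]_w (f x w)%:E)%E.
  by near do rewrite /f' max_l //.
apply: cvg_trans (_ : fine (\int[P]_w (f' x w)%:E)%E @[x --> +oo] --> _).
  by apply: near_eq_cvg; apply: filterS f'f => x /esym.
apply/cvg_pinftyP => u uoo.
have [ih _ cv] : [/\ P.-integrable setT (EFin \o h),
    (\int[P]_w `|(f' (u n) w)%:E - (h w)%:E| @[n --> \oo] --> 0)%E &
    (\int[P]_w (f' (u n) w)%:E @[n --> \oo] --> \int[P]_w (h w)%:E)%E].
  apply: (dominated_convergence measurableT (g := EFin \o g)) => //.
  - move=> n; apply/measurable_EFinP; apply: mf.
    by rewrite le_max lexx orbT.
  - exact/measurable_EFinP.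
  - apply: filterS fh => w fhw _; apply: cvg_EFin.
      by near=> n.
    have uoo' : Num.max (u n) x0 @[n --> \oo] --> +oo.
      have : \forall n \near \oo, x0 <= u n by move/cvgryPge : (uoo); exact.
      move=> hn; apply: cvg_trans uoo; apply: near_eq_cvg; move: hn.
      by apply: filterS => n h0; rewrite max_l.
    exact: (cvg_comp _ _ uoo' fhw).
  - apply: filterS fg => w fgw n _; rewrite lee_fin; apply: fgw.
    by rewrite le_max lexx orbT.
have hfin : (\int[P]_w (h w)%:E)%E \is a fin_num by exact: integrable_fin_num.
by apply: fine_cvg; rewrite fineK.
Unshelve. all: by end_near. Qed.

(** Two functions with the same limiting ratio [L] to a positive function are equivalent; when [L] is 0
    they have to vanish eventually, since the limits alone carry no information. *)
Lemma asymp_equiv_ratio (f g t : R -> R) (L : R) : (forall x, 0 < t x) -> 0 <= L ->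
  f x / t x @[x --> +oo] --> L -> g x / t x @[x --> +oo] --> L ->
  (L = 0 -> \forall x \near +oo, f x = 0 /\ g x = 0) ->
  asymp_equiv f g.
Proof.
move=> t0 L0 fL gL fg0; apply/asymp_equivP => e e0.
have [L00|Lneq0] := eqVneq L 0.
  apply: filterS (fg0 L00) => x [-> ->].
  by rewrite subrr normr0 mulr0.
have Lgt0 : 0 < L by rewrite lt_neqAle eq_sym Lneq0.
(* The solution of [2 * dl = e * (L - dl)]. *)
pose dl := e * L / (2 + e).
have dl0 : 0 < dl by rewrite divr_gt0 ?mulr_gt0// addr_gt0.
have dlE : 2 * dl = e * (L - dl) by rewrite /dl; field; lra.
near=> x.
have h1 : `|L - f x / t x| <= dl by near: x; move/cvgrPdist_le : fL; exact.
have h2 : `|L - g x / t x| <= dl by near: x; move/cvgrPdist_le : gL; exact.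
have tx := t0 x.
set a := f x / t x in h1; set b := g x / t x in h2.
have fa : f x = a * t x by rewrite /a divfK// gt_eqF.
have gb : g x = b * t x by rewrite /b divfK// gt_eqF.
rewrite fa gb; clearbody a b.
rewrite -mulrBl !normrM mulrA; apply: ler_wpM2r => //.
have h3 : `|a - b| <= 2 * dl.
  have -> : a - b = (L - b) - (L - a) by ring.
  by rewrite (le_trans (ler_normB _ _))// mulr_natl mulr2n lerD.
apply: (le_trans h3); rewrite dlE; apply: ler_wpM2l; first exact: ltW.
apply: le_trans (ler_norm _); move: h2; rewrite ler_norml => /andP[_]; lra.
Unshelve. all: by end_near. Qed.

End asymptotics_tools.

(** * The random tree and the conditional version of Hmu *)

Section law_transfer.
Context d (T : measurableType d) (R : realType) (P : probability T R).
Context (X : {RV P >-> R}) (F : probability R R).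
Hypothesis XF : has_law X F.

Lemma law_integrable : P.-integrable setT (EFin \o X) ->
  F.-integrable setT (EFin \o (@id R)).
Proof.
move=> /integrableP[_ Xoo]; apply/integrableP; split; first exact/measurable_EFinP.
rewrite (eq_measure_integral (distribution P X)); last by move=> A mA _; apply/esym; exact: XF.
rewrite ge0_integral_distribution//.
by apply: measurableT_comp => //; exact/measurable_EFinP.
Qed.

Lemma law_mean : P.-integrable setT (EFin \o X) ->
  (\int[F]_v v%:E = \int[P]_w (X w)%:E)%E.
Proof.
move=> iX; rewrite (eq_measure_integral (distribution P X)); last by move=> A mA _; apply/esym; exact: XF.
by rewrite integral_distribution//; exact/measurable_EFinP.
Qed.

End law_transfer.

Section random_tree.
Context d (T : measurableType d) (R : realType) (P : probability T R).
Context (zeta : nat -> nat -> {RV P >-> nat}) (mu : {RV P >-> nat}).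

(** All the vertices of a generation have the same offspring law, so the hypothesis on the first one
    extends to the others. *)
Lemma ae_no_dead_end (Phat : nat -> probability nat R) :
  (forall n j, has_law (zeta n j) (Phat n)) ->
  (forall n, {ae P, forall w, (1 <= zeta n 0%N w)%N}) ->
  {ae P, forall w, forall n j, (0 < offspring zeta w n j)%N}.
Proof.
move=> law ge1; apply: ae_foralln => n; apply: ae_foralln => j.
have m0 k : measurable (zeta n k @^-1` [set 0%N]).
  by rewrite -[X in measurable X]setTI; exact: measurable_funP.
have [A [mA A0 subA]] := ge1 n.
have z0 : P (zeta n 0%N @^-1` [set 0%N]) = 0%E.
  apply/eqP; rewrite eq_le measure_ge0 andbT -A0.
  apply: le_measure; rewrite ?inE// => w /= w0; apply: subA => /=.
  by rewrite w0.
exists (zeta n j @^-1` [set 0%N]); split => //.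
  have mn : measurable [set 0%N] by [].
  exact: (etrans (law n j _ mn) (etrans (esym (law n 0%N _ mn)) z0)).
by move=> w /= /negP; rewrite -leqNgt leqn0 => /eqP.
Qed.

Let mzeta n j : measurable_fun setT (zeta n j : T -> nat).
Proof. by []. Qed.

Lemma measurable_Zgen n : measurable_fun setT (Zgen zeta n).
Proof. exact: measurable_gen_size mzeta n. Qed.

Lemma measurable_Zmu : measurable_fun setT (fun w => Zgen zeta (mu w) w).
Proof. by apply: measurable_random_index => //; exact: measurable_Zgen. Qed.

Lemma measurable_eta : measurable_fun setT (eta_mu zeta mu).
Proof.
apply: (measurable_random_index
  (f := fun k w => (\sum_(1 <= n < k.+1) Zgen zeta n w)%N)) => // k.
exact: measurable_sum_nat measurable_Zgen.
Qed.

Lemma measurable_natr (f : T -> nat) : measurable_fun setT f ->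
  measurable_fun setT (fun w => (f w)%:R : R).
Proof. by move=> mf; apply: (measurableT_comp (f := fun n : nat => n%:R : R)). Qed.

(** The dominating variable. *)
Definition mu_Zmu_prod (w : T) : nat := (mu w * Zgen zeta (mu w) w)%N.

Lemma measurable_mu_Zmu : measurable_fun setT (fun w => (mu_Zmu_prod w)%:R : R).
Proof.
have -> : (fun w => (mu_Zmu_prod w)%:R : R) =
    fun w => (mu w)%:R * (Zgen zeta (mu w) w)%:R.
  by apply/funext => w; rewrite natrM.
by apply: measurable_funM; apply: measurable_natr => //; exact: measurable_Zmu.
Qed.

Lemma eta_le_mu_Zmu w : (forall n j, (0 < offspring zeta w n j)%N) ->
  (eta_mu zeta mu w <= mu_Zmu_prod w)%N.
Proof. exact: sum_gen_size_le. Qed.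

Lemma mu_Zmu_eq0 w : (forall n j, (0 < offspring zeta w n j)%N) ->
  eta_mu zeta mu w = 0%N -> mu_Zmu_prod w = 0%N.
Proof.
move=> z0; rewrite /eta_mu /mu_Zmu_prod; case: (mu w) => // m.
rewrite big_ltn// => /eqP; rewrite addn_eq0 => /andP[+ _].
by rewrite eqn0Ngt (gen_size_gt0 1 z0).
Qed.

Variables (F : probability R R) (c : R).
Hypothesis c0 : 0 < c.
Local Notation tb := (tail F).

(** The quantity whose mean is [Hmu]: the sum of the terms of the generations up to the horizon. The
    index [i] stands for the generation [i.+1]. *)
Definition Hcond x w : R :=
  \sum_(0 <= i < mu w) (Zgen zeta i.+1 w)%:R * tb (x + c * i.+1%:R).

Lemma measurable_Hcond x : measurable_fun setT (Hcond x).
Proof.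
apply: (measurable_random_index (f := fun k w =>
  \sum_(0 <= i < k) (Zgen zeta i.+1 w)%:R * tb (x + c * i.+1%:R))) => // k.
apply: measurable_sum => i; apply: measurable_funM => //.
exact/measurable_natr/measurable_Zgen.
Qed.

Lemma Hcond_ge0 x w : 0 <= Hcond x w.
Proof. by apply: sumr_ge0 => i _; rewrite mulr_ge0 ?tail_ge0. Qed.

Lemma Hmu_integral x : (Hmu zeta mu F c x = \int[P]_w (Hcond x w)%:E)%E.
Proof.
pose a i w : \bar R := ((Zgen zeta i.+1 w)%:R * \1_[set w' | (i.+1 <= mu w')%N] w
   * tb (x + c * i.+1%:R))%:E.
have mset i : measurable [set w' | (i <= mu w')%N].
  by apply: measurable_boolset; exact: measurable_fun_leq.
have mprod i : measurable_fun setT (fun w => (Zgen zeta i w)%:R * \1_[set w' | (i <= mu w')%N] w : R).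
  apply: measurable_funM; first exact/measurable_natr/measurable_Zgen.
  exact: measurable_indic.
have ma i : measurable_fun setT (a i).
  by apply/measurable_EFinP; apply: measurable_funM.
have a0 i w : (0 <= a i w)%E by rewrite lee_fin !mulr_ge0// tail_ge0.
rewrite /Hmu -(nneseries_addn (f := fun n =>
  ('E_P[(fun w => (Zgen zeta n w)%:R * \1_[set w' | (n <= mu w')%N] w)%R] *
     (tb (x + c * n%:R))%:E)%E)); last first.
  move=> i; rewrite mule_ge0 ?lee_fin ?tail_ge0// unlock.
  by apply: integral_ge0 => w _; rewrite lee_fin mulr_ge0.
transitivity (\sum_(0 <= i <oo) \int[P]_w a i w)%E.
  apply: eq_eseriesr => i _; rewrite addn1 unlock muleC -ge0_integralZl_EFin ?tail_ge0//.
  - by apply: eq_integral => w _; rewrite -EFinM mulrC.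
  - by apply/measurable_EFinP; exact: mprod.
rewrite -integral_nneseries//; apply: eq_integral => w _.
rewrite (nneseries_split 0 (mu w))// add0n eseries0 ?adde0; last first.
  by move=> i mi _; rewrite /a indicE memNset ?mulr0 ?mul0r//= ltnNge mi.
rewrite /Hcond -sumEFin !big_nat; apply: eq_bigr => i /andP[_ im].
by rewrite /a indicE mem_set//= mulr1.
Qed.

Lemma Hcond_le x w : Hcond x w <= (eta_mu zeta mu w)%:R * tb x.
Proof.
rewrite /Hcond /eta_mu big_add1/= natr_sum mulr_suml; apply: ler_sum => i _.
apply: ler_wpM2l => //; apply: tail_nonincreasing.
by rewrite lerDl mulr_ge0// ltW.
Qed.

Hypothesis Fsse : strong_subexponential F.

Lemma Hcond_cvg w :
  Hcond x w / tb x @[x --> +oo] --> ((eta_mu zeta mu w)%:R : R).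
Proof.
apply/cvgrPdist_le => e e0; set N : R := (eta_mu zeta mu w)%:R.
have N0 : 0 <= N by rewrite ler0n.
pose h := c * (mu w)%:R; have h0 : 0 <= h by rewrite mulr_ge0// ltW.
pose dl := e / (N + 1); have dl0 : 0 < dl by rewrite divr_gt0// ltr_wpDl.
have [M [_ MP]] := long_tailed Fsse h0 dl0.
near=> x.
have xM : M < x by near: x; apply: nbhs_pinfty_gt; exact: num_real.
have lt : tb x <= (1 + dl) * tb (x + h).
  by have := MP (x + h); rewrite addrK; apply; lra.
have tx := tail_gt0 Fsse x; have txh := tail_gt0 Fsse (x + h).
have hta : tb (x + h) <= tb x by apply: tail_nonincreasing; lra.
have low : N * tb (x + h) <= Hcond x w.
  rewrite /N /Hcond /eta_mu big_add1/= natr_sum mulr_suml !big_nat.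
  apply: ler_sum => i /andP[_ im]; apply: ler_wpM2l => //.
  by apply: tail_nonincreasing; rewrite lerD2l ler_wpM2l ?(ltW c0)// ler_nat.
have up : Hcond x w <= N * tb x := Hcond_le x w.
have -> : N - Hcond x w / tb x = (N * tb x - Hcond x w) / tb x.
  by rewrite mulrBl mulfK// gt_eqF.
rewrite ger0_norm; last by apply: divr_ge0; [rewrite subr_ge0|exact: ltW].
rewrite ler_pdivrMr//.
have eE : e = dl * N + dl by rewrite /dl; field; lra.
have h1 : N * (tb x - tb (x + h)) <= N * (dl * tb x).
  apply: ler_wpM2l => //.
  have : dl * tb (x + h) <= dl * tb x by rewrite ler_wpM2l// ltW.
  by lra.
have h2 : 0 <= dl * tb x by rewrite mulr_ge0// ltW.
by rewrite eE; lra.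
Unshelve. all: by end_near. Qed.

End random_tree.

(** * The maximum over the random tree *)

Section single_big_jump.
Context d (T : measurableType d) (R : realType) (P : probability T R).
Context (zeta : nat -> nat -> {RV P >-> nat}) (xi : nat -> nat -> {RV P >-> R}).
Context (mu : {RV P >-> nat}) (F : probability R R) (c : R).
Local Notation tb := (tail F).
Local Notation eta := (eta_mu zeta mu).
Local Notation good w := (forall n j, (0 < offspring zeta w n j)%N).

Hypothesis xi_law : forall i k, has_law (xi i k) F.
Hypothesis xi_indep : independent_RVs (fun ik : nat * nat => xi ik.1 ik.2).
Hypothesis indep : independent P
  (sigma_family (fun ik : nat * nat => xi ik.1 ik.2))
  <<s g_sigma_algebra_preimage mu `|`
      sigma_family (fun nj : nat * nat => zeta nj.1 nj.2) >>.
Hypothesis Fint : F.-integrable setT (EFin \o (@id R)).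
Hypothesis Fmean : (\int[F]_v v%:E = 0)%E.
Hypothesis Fsse : strong_subexponential F.
Hypothesis c0 : 0 < c.
Hypothesis ae_good : {ae P, forall w, good w}.
Hypothesis mu_Zmu : (\int[P]_w ((mu_Zmu_prod zeta mu w)%:R)%:E < +oo)%E.

Let Q x w := frozen_tree_prob zeta xi mu c x w.

Lemma frozen_tree_prob_fin x w : Q x w \is a fin_num.
Proof. by apply: fin_num_measure; exact: measurable_excess_section. Qed.

Lemma frozen_tree_prob_cvg w : fine (Q x w) / tb x @[x --> +oo] --> ((eta w)%:R : R).
Proof.
apply/cvgrPdist_le => e e0.
have up := fixed_tree_upper xi_indep xi_law Fsse c0 (offspring zeta w) (mu w) e0.
have low := fixed_tree_lower xi_indep xi_law Fsse c0 (offspring zeta w) (mu w) e0.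
rewrite size_tree_edges in up low.
near=> x; have tx := tail_gt0 Fsse x.
have h1 : (Q x w <= (((eta w)%:R + e) * tb x)%:E)%E by near: x.
have h2 : ((eta w)%:R - e) * tb x <= fine (Q x w) by near: x.
have {}h1 : fine (Q x w) <= ((eta w)%:R + e) * tb x.
  by rewrite -lee_fin fineK// frozen_tree_prob_fin.
rewrite distrC ler_norml; apply/andP; split.
  by rewrite lerBrDl ler_pdivlMr.
by rewrite lerBlDl ler_pdivrMr.
Unshelve. all: by end_near. Qed.

Lemma integrable_mu_Zmu (k : R) :
  P.-integrable setT (EFin \o (fun w => k * (mu_Zmu_prod zeta mu w)%:R)).
Proof.
have -> : EFin \o (fun w => k * (mu_Zmu_prod zeta mu w)%:R) =
    (fun w => k%:E * ((mu_Zmu_prod zeta mu w)%:R)%:E)%E.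
  by apply/funext => w /=; rewrite EFinM.
apply: integrableZl => //; apply/integrableP; split.
  by apply/measurable_EFinP; exact: measurable_mu_Zmu.
under eq_integral do rewrite gee0_abs ?lee_fin//.
exact: mu_Zmu.
Qed.

Let L : R := fine (\int[P]_w ((eta w)%:R)%:E)%E.

Let measurable_eta_R : measurable_fun setT (fun w => (eta w)%:R : R).
Proof. exact/measurable_natr/measurable_eta. Qed.

(** Ratios dominated by a multiple of [mu * Z_mu] and converging to [eta_mu]: their means converge to
    the mean of [eta_mu], and vanish if that mean is 0, since then [mu] is 0 almost surely. *)
Lemma ratio_limit (f : R -> T -> R) (k x0 : R) :
  (forall x, measurable_fun setT (f x)) ->
  (forall w x, good w -> x0 <= x -> `|f x w| <= k * (mu_Zmu_prod zeta mu w)%:R) ->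
  (forall w, f x w @[x --> +oo] --> ((eta w)%:R : R)) ->
  fine (\int[P]_w (f x w)%:E)%E @[x --> +oo] --> L /\
  (L = 0 -> forall x, x0 <= x -> fine (\int[P]_w (f x w)%:E)%E = 0).
Proof.
move=> mf fk feta; split.
  apply: (@dominated_cvg_pinfty _ _ _ _ f _ (fun w => k * (mu_Zmu_prod zeta mu w)%:R) x0) => //.
  - exact: integrable_mu_Zmu.
  - by apply: filterS ae_good => w gw x; exact: fk.
  - by apply: aeW => w; exact: feta.
move=> L0 x x0x.
have ieta : (\int[P]_w ((eta w)%:R)%:E)%E \is a fin_num.
  rewrite ge0_fin_numE; last by apply: integral_ge0 => w _; rewrite lee_fin.
  apply: le_lt_trans mu_Zmu; apply: ae_ge0_le_integral => //.
  - exact/measurable_EFinP.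
  - by apply/measurable_EFinP; exact: measurable_mu_Zmu.
  - apply: filterS ae_good => w gw _; rewrite lee_fin ler_nat.
    exact: eta_le_mu_Zmu.
have eta0 : ae_eq P setT (fun w => ((eta w)%:R : R)%:E) (cst 0%E).
  apply/ae_eq_integral_abs => //; first exact/measurable_EFinP.
  under eq_integral do rewrite gee0_abs ?lee_fin//.
  by rewrite -[LHS]fineK// -/L L0.
rewrite (ae_eq_integral (cst 0%E))//; last 2 first.
- exact/measurable_EFinP.
- apply: filterS2 ae_good eta0 => w gw /(_ I)[] ew _.
  have /eqP : (eta w)%:R = 0 :> R := ew.
  rewrite pnatr_eq0 => /eqP /(mu_Zmu_eq0 gw) m0.
  have := fk w x gw x0x; rewrite m0 mulr0 normr_le0 => /eqP ->//.
by rewrite integral0.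
Qed.

Lemma Rmax_ratio x : fine (P [set w | x < Rmax zeta mu xi c w]) / tb x =
  fine (\int[P]_w (fine (Q x w) / tb x)%:E)%E.
Proof.
have tx := tail_gt0 Fsse x.
have mQ : measurable_fun setT (Q x) by exact: measurable_frozen_tree_prob.
rewrite (Rmax_tailE indep).
rewrite [in RHS](eq_integral (fun w => ((tb x)^-1)%:E * Q x w)%E); last first.
  by move=> w _; rewrite EFinM fineK ?frozen_tree_prob_fin// muleC.
rewrite ge0_integralZl_EFin ?invr_ge0 ?(ltW tx)//.
rewrite fineM//= 1?mulrC//.
rewrite ge0_fin_numE ?integral_ge0//.
rewrite -(Rmax_tailE indep); apply: (le_lt_trans (probability_le1 _ _)).
  exact: measurable_Rmax.
by rewrite ltry.
Qed.

Lemma Hmu_ratio x : fine (Hmu zeta mu F c x) / tb x =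
  fine (\int[P]_w (Hcond zeta mu F c x w / tb x)%:E)%E.
Proof.
have tx := tail_gt0 Fsse x.
have mH : measurable_fun setT (fun w => (Hcond zeta mu F c x w)%:E).
  by apply/measurable_EFinP; exact: measurable_Hcond.
rewrite Hmu_integral.
rewrite [in RHS](eq_integral (fun w => ((tb x)^-1)%:E * (Hcond zeta mu F c x w)%:E)%E); last first.
  by move=> w _; rewrite -EFinM mulrC.
rewrite ge0_integralZl_EFin ?invr_ge0 ?(ltW tx)//; last first.
  by move=> w _; rewrite lee_fin Hcond_ge0.
have H0 : (0 <= \int[P]_w (Hcond zeta mu F c x w)%:E)%E.
  by apply: integral_ge0 => w _; rewrite lee_fin Hcond_ge0.
rewrite fineM//= 1?mulrC//.
rewrite ge0_fin_numE//.
apply: (@le_lt_trans _ _ (\int[P]_w ((mu_Zmu_prod zeta mu w)%:R)%:E)%E) => //.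
apply: ae_ge0_le_integral => //.
- by move=> w _; rewrite lee_fin Hcond_ge0.
- by apply/measurable_EFinP; exact: measurable_mu_Zmu.
- apply: filterS ae_good => w gw _; rewrite lee_fin.
  apply: (le_trans (Hcond_le _ _ _ c0 _ _)).
  rewrite -[leRHS]mulr1; apply: ler_pM => //; rewrite ?tail_ge0 ?tail_le1//.
  by rewrite ler_nat; exact: eta_le_mu_Zmu.
Qed.

Lemma Rmax_Hmu_tail :
  asymp_equiv (fun x => fine (P [set w | x < Rmax zeta mu xi c w]))
              (fun x => fine (Hmu zeta mu F c x)) /\
  asymp_equiv (fun x => fine (Hmu zeta mu F c x)) (fun x => L * tb x).
Proof.
have [C [x0 [C0 x00 hC]]] := fixed_tree_bound xi_indep xi_law Fint Fmean Fsse c0.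
have t0 := tail_gt0 Fsse.
have L0 : 0 <= L by apply: fine_ge0; apply: integral_ge0 => w _; rewrite lee_fin.
have [Pcvg P0] : fine (P [set w | x < Rmax zeta mu xi c w]) / tb x @[x --> +oo] --> L /\
    (L = 0 -> forall x, x0 <= x -> fine (P [set w | x < Rmax zeta mu xi c w]) / tb x = 0).
  have [||w|cv z0] := @ratio_limit (fun x w => fine (Q x w) / tb x) C x0.
  - move=> x; apply: measurable_funM => //.
    apply: (measurableT_comp (f := fine)) => //.
    exact: measurable_frozen_tree_prob.
  - move=> w x gw x0x; rewrite ger0_norm; last first.
      by apply: divr_ge0; [exact: fine_ge0|exact: ltW].
    rewrite ler_pdivrMr// -lee_fin fineK ?frozen_tree_prob_fin//.
    by rewrite (mulrC C); exact: hC.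
  - exact: frozen_tree_prob_cvg.
  split; last by move=> L00 x x0x; rewrite Rmax_ratio z0.
  by under eq_cvg do rewrite Rmax_ratio.
have [Hcvg H0] : fine (Hmu zeta mu F c x) / tb x @[x --> +oo] --> L /\
    (L = 0 -> forall x, x0 <= x -> fine (Hmu zeta mu F c x) / tb x = 0).
  have [||w|cv z0] := @ratio_limit (fun x w => Hcond zeta mu F c x w / tb x) 1 x0.
  - by move=> x; apply: measurable_funM => //; exact: measurable_Hcond.
  - move=> w x gw x0x; rewrite ger0_norm; last first.
      by apply: divr_ge0; [exact: Hcond_ge0|exact: ltW].
    rewrite mul1r ler_pdivrMr//; apply: (le_trans (Hcond_le _ _ _ c0 _ _)).
    by rewrite ler_wpM2r ?tail_ge0// ler_nat; exact: eta_le_mu_Zmu.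
  - exact: Hcond_cvg.
  split; last by move=> L00 x x0x; rewrite Hmu_ratio z0.
  by under eq_cvg do rewrite Hmu_ratio.
have nul (a : R) x : a / tb x = 0 -> a = 0.
  by move=> /eqP; rewrite mulf_eq0 invr_eq0 (gt_eqF (t0 x)) orbF => /eqP.
have near0 : \forall x \near +oo, x0 <= x by apply: nbhs_pinfty_ge; exact: num_real.
split.
- apply: (asymp_equiv_ratio t0 L0 Pcvg Hcvg) => L00.
  apply: filterS near0 => x x0x.
  by split; apply: nul; [exact: P0|exact: H0].
- apply: (asymp_equiv_ratio t0 L0 Hcvg) => [|L00].
    under eq_cvg do rewrite mulfK ?gt_eqF//.
    exact: cvg_cst.
  apply: filterS near0 => x x0x; rewrite L00 mul0r; split => //.
  by apply: nul; exact: H0.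
Qed.

End single_big_jump.

Unset Implicit Arguments.
Set Strict Implicit.
Set Printing Implicit Defensive.

Theorem theorem2 (R : realType) (d : measure_display) (T : measurableType d)
  (P : probability T R)
  (Phat : nat -> probability nat R)
  (zeta : nat -> nat -> {RV P >-> nat})
  (zeta_law : forall n j, has_law (zeta n j) (Phat n))
  (zeta_indep : forall n, independent_RVs (zeta n))
  (zeta_gen_indep : mutually_independent P (fun n => sigma_family (zeta n)))
  (F : probability R R)
  (xi : nat -> nat -> {RV P >-> R})
  (xi_law : forall i k, has_law (xi i k) F)
  (xi_indep : independent_RVs (fun ik : nat * nat => xi ik.1 ik.2))
  (mu : {RV P >-> nat})
  (zeta_ge1 : forall n, {ae P, forall w, (1 <= zeta n 0%N w)%N})
  (xi_integrable : P.-integrable setT (EFin \o xi 0%N 0%N))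
  (xi_centered : ('E_P[xi 0%N 0%N] = 0)%E)
  (xi_zeta_indep : independent P
     (sigma_family (fun ik : nat * nat => xi ik.1 ik.2))
     (sigma_family (fun nj : nat * nat => zeta nj.1 nj.2)))
  (xi_mu_zeta_indep : independent P
     (sigma_family (fun ik : nat * nat => xi ik.1 ik.2))
     <<s g_sigma_algebra_preimage mu `|`
         sigma_family (fun nj : nat * nat => zeta nj.1 nj.2) >>)
  (mu_Zmu : ('E_P[(fun w => (mu w * Zgen zeta (mu w) w)%:R)%R] < +oo)%E)
  (F_sse : strong_subexponential F)
  (c : R) (c_gt0 : 0 < c) :
  asymp_equiv (fun x => fine (P [set w | x < Rmax zeta mu xi c w]))
              (fun x => fine (Hmu zeta mu F c x)) /\
  asymp_equiv (fun x => fine (Hmu zeta mu F c x))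
              (fun x => fine 'E_P[(fun w => (eta_mu zeta mu w)%:R)%R]%E * tail F x).
Proof.
have Fint := law_integrable (xi_law 0%N 0%N) xi_integrable.
have Fmean : (\int[F]_v v%:E = 0)%E.
  by rewrite (law_mean (xi_law 0%N 0%N) xi_integrable) -[RHS]xi_centered unlock.
have good := ae_no_dead_end zeta_law zeta_ge1.
have hmu : (\int[P]_w ((mu_Zmu_prod zeta mu w)%:R)%:E < +oo)%E.
  by move: mu_Zmu; rewrite unlock.
have := Rmax_Hmu_tail xi_law xi_indep xi_mu_zeta_indep Fint Fmean F_sse c_gt0 good hmu.
by rewrite unlock.
Qed.
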